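(* Let $H$ and $G$ be separable real Hilbert spaces and let $X=\{X_t\}_{t\in\mathbb{R}_+}$ be a cylindrical Lévy process over $H$ such that for every $t\in\mathbb{R}_+$ the linear map $X_t:H\rightarrow L^0(\Omega,\mathcal{F},\mathbb{P})$ is continuous. If $S\in\mathcal{L}_2(H,G)$, then there exists a unique (up to indistinguishability) $G$-valued Lévy process $Y=\{Y_t\}_{t\in\mathbb{R}_+}\in D(G)$ (respectively $Y\in C(G)$ if the cylindrical Lévy process $X$ has continuous paths) that is a version of the cylindrical process $X\circ S^*=\{X_t\circ S^*\}_{t\in\mathbb{R}_+}$; that is, for each $t\in\mathbb{R}_+$ and $g\in G$, $\langle Y_t,g\rangle=X_t(S^*g)$ $\mathbb{P}$-a.e.
   Context: $(\Omega,\mathcal{F},\mathbb{P})$ is a complete probability space. $L^0(\Omega,\mathcal{F},\mathbb{P})$ is the space of equivalence classes of real random variables with the topology of convergence in probability. $\mathcal{L}_2(H,G)$ is the space of Hilbert-Schmidt operators from $H$ to $G$, and $S^*:G\to H$ is the adjoint of $S$ (Hilbert spaces are identified with their duals). A cylindrical random variable over $H$ is a linear map $H\to L^0(\Omega,\mathcal{F},\mathbb{P})$. A cylindrical process over $H$ is a family $X=\{X_t\}_{t\in\mathbb{R}_+}$ of cylindrical random variables over $H$. It has càdlàg (respectively continuous) paths if for every $h\in H$ the real process $\{X_t(h)\}_{t\in\mathbb{R}_+}$ has càdlàg (respectively continuous) paths, i.e. representatives of the classes $X_t(h)$, $t\ge 0$, are chosen so that this holds. A process $L=\{L_t\}_{t\in\mathbb{R}_+}$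 with values in a Hilbert space (in particular $\mathbb{R}^n$) is a Lévy process if $L_0=0$ $\mathbb{P}$-a.s., it is stochastically continuous, and it has stationary and independent increments. A cylindrical process $L=\{L_t\}_{t\in\mathbb{R}_+}$ over $H$ is a cylindrical Lévy process if for all $n$ and all $h_1,\dots,h_n\in H$ the process $\{(L_t(h_1),\dots,L_t(h_n))\}_{t\in\mathbb{R}_+}$ is an $\mathbb{R}^n$-valued Lévy process. $D(G)$ (respectively $C(G)$) denotes the space of $G$-valued processes indexed by $\mathbb{R}_+$ with càdlàg (respectively continuous) paths. *)

(* Defs.v *)
From HB Require Import structures.
From mathcomp Require Import all_boot all_order all_algebra.
From mathcomp Require Import sesquilinear.
From mathcomp Require Import all_classical all_reals.
From mathcomp Require Import ereal topology normedtype sequences esum measure.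
From mathcomp Require Import measurable_realfun lebesgue_measure.
From mathcomp Require Import lebesgue_integral hoelder probability.

Set Implicit Arguments.
Unset Strict Implicit.
Unset Printing Implicit Defensive.

Import Order.TTheory GRing.Theory Num.Theory.
Import numFieldNormedType.Exports.

Local Open Scope classical_set_scope.
Local Open Scope ring_scope.

HB.mixin Record CompleteNormedModule_isHilbert (R : realType) (H : Type)
    of CompleteNormedModule R H := {
  dotp : {dot H for (@idfun R)} ;
  dotpE : forall x : H, dotp x x = `|x| ^+ 2
}.

#[short(type="hilbertType")]
HB.structure Definition Hilbert (R : realType) :=
  {H of CompleteNormedModule R H & CompleteNormedModule_isHilbert R H}.

Definition separable (T : topologicalType) :=
  exists2 D : set T, countable D & dense D.

Section operators.
Context {R : realType} {H G : hilbertType R}.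
Implicit Types (S : {linear H -> G}) (B : set H).

Definition orthonormal_set B :=
  forall e f, B e -> B f -> dotp e f = (e == f)%:R.

Definition orthonormal_basis B :=
  orthonormal_set B /\
  forall x : H, (forall e, B e -> dotp x e = 0) -> x = 0.

(* For bounded S the sum does not depend on the orthonormal basis. *)
Definition hilbert_schmidt S :=
  continuous S /\
  exists2 B : set H, orthonormal_basis B &
    (\esum_(e in B) (`|S e| ^+ 2)%:E < +oo)%E.

(* The point 0 is a dummy: the adjoint equation determines a unique vector,   *)
(* which exists by the Riesz representation theorem when S is bounded.        *)
Definition adjoint S (g : G) : H :=
  xget 0 [set a | forall h, dotp (S h) g = dotp h a].

End operators.

(* {mfun_ P, T >-> R} is the quotient of the real random variables by P-a.e.  *)
(* equality; an element of it coerces to a representative function.           *)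
Definition L0 d (T : measurableType d) (R : realType) (P : probability T R) :=
  {mfun_ P, T >-> R}.

Identity Coercion L0_aeEqMfun : L0 >-> aeEqMfun.

Section L0_theory.
Local Open Scope quotient_scope.
Context {d} {T : measurableType d} {R : realType} (P : probability T R).
Implicit Types (f g h : L0 P) (k : R).

Definition L0_class (f : {mfun T >-> R}) : L0 P := \pi_(L0 P) f.

Lemma L0_classE (f : {mfun T >-> R}) : {ae P, forall w, L0_class f w = f w}.
Proof.
have /eqmodP/asboolP : repr (L0_class f) = f %[mod @aeEqMfun _ _ R T R P].
  by rewrite reprK.
by apply: filterS => w /(_ I).
Qed.

Lemma L0_eqP f g : {ae P, forall w, f w = g w} -> f = g.
Proof.
move=> fg; rewrite -[f]reprK -[g]reprK.
by apply/eqmodP/asboolP; apply: filterS fg.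
Qed.

Lemma measurable_L0 f : measurable_fun setT f.
Proof. exact: (measurable_funPT (repr f)). Qed.

Definition L0_zero : L0 P := L0_class 0.
Definition L0_opp f : L0 P := L0_class (- (repr f : {mfun T >-> R})).
Definition L0_add f g : L0 P :=
  L0_class ((repr f : {mfun T >-> R}) + (repr g : {mfun T >-> R})).
Definition L0_scale k f : L0 P := L0_class (k *: (repr f : {mfun T >-> R})).

Let L0_zeroE : {ae P, forall w, L0_zero w = 0}.
Proof. exact: L0_classE. Qed.

Let L0_oppE f : {ae P, forall w, L0_opp f w = - f w}.
Proof. exact: L0_classE. Qed.

Let L0_addE f g : {ae P, forall w, L0_add f g w = f w + g w}.
Proof. exact: L0_classE. Qed.

Let L0_scaleE k f : {ae P, forall w, L0_scale k f w = k * f w}.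
Proof. exact: L0_classE. Qed.

Let addA : associative L0_add.
Proof.
move=> f g h; apply: L0_eqP; near=> w.
rewrite (near (L0_addE f (L0_add g h)) w)// (near (L0_addE g h) w)//.
by rewrite (near (L0_addE (L0_add f g) h) w)// (near (L0_addE f g) w)// addrA.
Unshelve. all: by end_near. Qed.

Let addC : commutative L0_add.
Proof.
move=> f g; apply: L0_eqP; near=> w.
by rewrite (near (L0_addE f g) w)// (near (L0_addE g f) w)// addrC.
Unshelve. all: by end_near. Qed.

Let add0 : left_id L0_zero L0_add.
Proof.
move=> f; apply: L0_eqP; near=> w.
by rewrite (near (L0_addE L0_zero f) w)// (near L0_zeroE w)// add0r.
Unshelve. all: by end_near. Qed.

Let addN : left_inverse L0_zero L0_opp L0_add.
Proof.
move=> f; apply: L0_eqP; near=> w.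
rewrite (near (L0_addE (L0_opp f) f) w)// (near (L0_oppE f) w)//.
by rewrite (near L0_zeroE w)// addNr.
Unshelve. all: by end_near. Qed.

HB.instance Definition _ := Choice.on (L0 P).
HB.instance Definition _ := GRing.isZmodule.Build (L0 P) addA addC add0 addN.

Lemma L0_0E : {ae P, forall w, (0 : L0 P) w = 0}.
Proof. exact: L0_zeroE. Qed.

Lemma L0_NE f : {ae P, forall w, (- f : L0 P) w = - f w}.
Proof. exact: L0_oppE. Qed.

Lemma L0_DE f g : {ae P, forall w, (f + g : L0 P) w = f w + g w}.
Proof. exact: L0_addE. Qed.

Let scaleA k l f : L0_scale k (L0_scale l f) = L0_scale (k * l) f.
Proof.
apply: L0_eqP; near=> w.
rewrite (near (L0_scaleE k (L0_scale l f)) w)// (near (L0_scaleE l f) w)//.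
by rewrite (near (L0_scaleE (k * l) f) w)// mulrA.
Unshelve. all: by end_near. Qed.

Let scale1 : left_id 1 L0_scale.
Proof.
move=> f; apply: L0_eqP; near=> w.
by rewrite (near (L0_scaleE 1 f) w)// mul1r.
Unshelve. all: by end_near. Qed.

Let scaleDr : right_distributive L0_scale +%R.
Proof.
move=> k f g; apply: L0_eqP; near=> w.
rewrite (near (L0_scaleE k (f + g)) w)// (near (L0_DE f g) w)//.
rewrite (near (L0_DE (L0_scale k f) (L0_scale k g)) w)//.
by rewrite (near (L0_scaleE k f) w)// (near (L0_scaleE k g) w)// mulrDr.
Unshelve. all: by end_near. Qed.

Let scaleDl f : {morph L0_scale^~ f : k l / k + l}.
Proof.
move=> k l; apply: L0_eqP; near=> w.
rewrite (near (L0_scaleE (k + l) f) w)//.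
rewrite (near (L0_DE (L0_scale k f) (L0_scale l f)) w)//.
by rewrite (near (L0_scaleE k f) w)// (near (L0_scaleE l f) w)// mulrDl.
Unshelve. all: by end_near. Qed.

HB.instance Definition _ :=
  GRing.Zmodule_isLmodule.Build R (L0 P) scaleA scale1 scaleDr scaleDl.

Lemma L0_ZE k f : {ae P, forall w, (k *: f : L0 P) w = k * f w}.
Proof. exact: L0_scaleE. Qed.

(* Ky Fan balls, which induce the topology of convergence in probability; see *)
(* cvg_L0P.                                                                   *)
Definition L0_ball f (e : R) : set (L0 P) :=
  [set g | (P [set w | (e <= `|f w - g w|)%R] < e%:E)%E].

Let measurable_dist f g : measurable_fun setT (fun w => `|f w - g w|).
Proof.
apply: measurableT_comp => //.
by apply: measurable_funB; exact: measurable_L0.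
Qed.

Lemma measurable_dist_ge f g (e : R) :
  measurable [set w | e <= `|f w - g w|].
Proof.
rewrite -[X in measurable X]setTI.
by apply: measurable_fun_le => //; exact: measurable_cst.
Qed.

Let ball_center f (e : R) : 0 < e -> L0_ball f e f.
Proof.
move=> e0; rewrite /L0_ball /=.
rewrite (_ : [set _ | _] = set0) ?measure0 ?lte_fin//.
by apply/seteqP; split=> // w /=; rewrite subrr normr0 leNgt e0.
Qed.

Let ball_sym f g (e : R) : L0_ball f e g -> L0_ball g e f.
Proof.
by rewrite /L0_ball /=; under eq_set do rewrite distrC.
Qed.

Let ball_triangle f g h (e1 e2 : R) :
  L0_ball f e1 g -> L0_ball g e2 h -> L0_ball f (e1 + e2) h.
Proof.
rewrite /L0_ball /= => fg gh; rewrite EFinD.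
apply: le_lt_trans (lteD fg gh).
apply: le_trans (measureU2 _ (measurable_dist_ge f g e1)
  (measurable_dist_ge g h e2)).
apply: le_measure; rewrite ?inE//; first exact: measurable_dist_ge.
  by apply: measurableU; exact: measurable_dist_ge.
move=> w /= efh; apply/orP; rewrite -implyNb -ltNge; apply/implyP => fge.
rewrite leNgt; apply/negP => ghe.
move: efh; apply/negP; rewrite -ltNge.
by rewrite (le_lt_trans (ler_distD (g w) _ _))// ltrD.
Qed.

HB.instance Definition _ :=
  hasNbhs.Build (L0 P) (nbhs_ (entourage_ L0_ball)).
HB.instance Definition _ := @Nbhs_isPseudoMetric.Build R (L0 P)
  (entourage_ L0_ball) erefl L0_ball ball_center ball_sym ball_triangle erefl.

Lemma cvg_L0P (I : Type) (F : set_system I) (FF : Filter F)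
    (f_ : I -> L0 P) f :
  f_ @ F --> f <->
  forall e : R, 0 < e ->
    P [set w | (e <= `|f w - f_ i w|)%R] @[i --> F] --> 0%E.
Proof.
split=> [/cvg_ballP ff e e0|ff].
- apply/fine_cvgP; split.
    by near=> i; rewrite fin_num_measure//; exact: measurable_dist_ge.
  apply/cvgr0Pnorm_lt => r r0.
  have m0 : 0 < Num.min e r by rewrite lt_min e0.
  near=> i.
  have fi : ball f (Num.min e r) (f_ i) by near: i; exact: ff.
  rewrite ger0_norm ?fine_ge0//.
  rewrite -lte_fin fineK ?fin_num_measure//; last exact: measurable_dist_ge.
  apply: (@le_lt_trans _ _ (P [set w | Num.min e r <= `|f w - f_ i w|])).
    apply: le_measure; rewrite ?inE; try exact: measurable_dist_ge.
    by move=> w /=; apply: le_trans; rewrite ge_min lexx.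
  apply: lt_le_trans fi _.
  by rewrite lee_fin ge_min lexx orbT.
- apply/cvg_ballP => e e0.
  have /fine_cvgP[_ /cvgr0Pnorm_lt /(_ _ e0) h] := ff _ e0.
  near=> i; rewrite /ball /=.
  have : `|fine (P [set w | e <= `|f w - f_ i w|])| < e by near: i.
  rewrite ger0_norm ?fine_ge0// -lte_fin fineK// fin_num_measure//.
  exact: measurable_dist_ge.
Unshelve. all: by end_near. Qed.

End L0_theory.

(* Processes are indexed by R, but only the times t >= 0 are constrained.     *)

Section processes.
Context {d} {T : measurableType d} {R : realType} (P : probability T R).
Context {E : normedModType R}.
Implicit Types Y Z : R -> T -> E.

Definition borel_set : set (set E) := <<s @open E >>.

Definition random_element (U : T -> E) :=
  measurable_fun setT (U : T -> g_sigma_algebraType (@open E)).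

Definition mutually_independent n (U : 'I_n -> T -> E) :=
  forall (J : {set 'I_n}) (B : 'I_n -> set E), (forall i, borel_set (B i)) ->
    P (\bigcap_(i in [set` J]) (U i @^-1` B i)) =
    (\prod_(i in J) P (U i @^-1` B i))%E.

Definition stochastically_continuous Y :=
  forall t, 0 <= t -> forall e : R, 0 < e ->
    P [set w | e <= `|Y s w - Y t w|]
      @[s --> within [set s | 0 <= s] (nbhs t)] --> 0%E.

Definition stationary_increments Y :=
  forall s h, 0 <= s -> 0 <= h -> forall B, borel_set B ->
    P ((fun w => Y (s + h) w - Y s w) @^-1` B) =
    P ((fun w => Y h w - Y 0 w) @^-1` B).

Definition independent_increments Y :=
  forall (n : nat) (t : nat -> R), 0 <= t 0 -> nondecreasing_seq t ->
    mutually_independent (fun (i : 'I_n) w => Y (t i.+1) w - Y (t i) w).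

Definition levy_process Y :=
  (forall t, 0 <= t -> random_element (Y t)) /\
  [/\ {ae P, forall w, Y 0 w = 0},
      stochastically_continuous Y,
      stationary_increments Y &
      independent_increments Y].

Definition continuous_paths Y :=
  forall w, {within [set t | 0 <= t], continuous (Y^~ w)}.

Definition cadlag_paths Y :=
  forall w t, 0 <= t ->
    Y s w @[s --> t^'+] --> Y t w /\
    (0 < t -> cvg (Y s w @[s --> t^'-])).

Definition indistinguishable Y Z :=
  {ae P, forall w, forall t, 0 <= t -> Y t w = Z t w}.

Definition exists_unique_upto_indistinguishability (Q : (R -> T -> E) -> Prop) :=
  exists2 Y, Q Y & forall Z, Q Z -> indistinguishable Y Z.

End processes.

Section cylindrical_processes.
Context {d} {T : measurableType d} {R : realType} {P : probability T R}.
Context {H G : hilbertType R}.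
Implicit Types X : R -> {linear H -> L0 P}.

(* 'rV[R]_n carries the sup norm, which is equivalent to the Euclidean one,   *)
(* hence has the same open sets, Borel sets and convergence in probability.   *)
(* Being a Levy process does not depend on the representatives of X t (h i).  *)
Definition cylindrical_levy X :=
  forall n (h : 'I_n -> H),
    levy_process P (fun t w => \row_(i < n) (X t (h i) : L0 P) w).

Definition cylindrical_continuous_paths X :=
  forall h : H, exists2 Z : R -> {mfun T >-> R},
    forall t, 0 <= t -> X t h = L0_class P (Z t) & continuous_paths Z.

Definition version_of_comp_adjoint X (S : {linear H -> G}) (Y : R -> T -> G) :=
  forall t, 0 <= t -> forall g : G,
    {ae P, forall w, dotp (Y t w) g = (X t (adjoint S g) : L0 P) w}.

End cylindrical_processes.

(* Main.v *)
Require Import Defs.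
From mathcomp Require Import all_boot all_order all_algebra.
From mathcomp Require Import sesquilinear ring lra.
From mathcomp Require Import all_classical all_reals.
From mathcomp Require Import ereal topology normedtype sequences esum measure.
From mathcomp Require Import measurable_realfun lebesgue_measure.
From mathcomp Require Import numfun lebesgue_integral hoelder probability.

Set Implicit Arguments.
Unset Strict Implicit.
Unset Printing Implicit Defensive.

Import Order.TTheory GRing.Theory Num.Theory.
Import numFieldNormedType.Exports.

Local Open Scope classical_set_scope.
Local Open Scope ring_scope.

(** Let f be a total orthonormal sequence of G and A = S^*. Since S is
    Hilbert-Schmidt, the sum C of the |A f_j|^2 is finite, and the process must
    be Z_t = sum_j X_t(A f_j) f_j. Four points have to be proved.

    The series converges a.s. Average over independent signs s_j: the mean of
    |sum_j s_j A f_j|^2 is at most C, so most signed sums are bounded in H and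
    have images under X_t that are bounded in probability. By the Paley-Zygmund
    inequality, a sum of squares is controlled by the typical size of its
    signed sums, which bounds sum_j X_t(A f_j)^2 in probability
    (prob_sum_sqr_le, sum_sqr_bounded). Continuity of X_t then gives
    <Z_t, g> = X_t(A g) a.s. (dotp_l0_series).

    Every version is a Levy process (version_levy). The cylinder sets on the
    coordinates along f form a pi-system that generates the Borel sets of G, and
    on them the laws of increments are those of finitely many X_t(A f_j). For
    stochastic continuity in norm, the tail of the series must be small for all
    small t at once; this is the sign-averaging bound applied to a bound on the
    X_t that Baire's theorem makes uniform in t (equicontinuous_at0).

    A stochastically continuous process with independent increments has a
    cadlag modification (exists_cadlag_modification). On a time interval so
    short that increments exceed e with probability at most 1/3, the
    probability of p successive oscillations of size 4e is at most 2^-p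
    (prob_moves_le, after Ottaviani). So almost surely the restriction of a path
    to the rational times has finitely many oscillations of each size locally,
    hence one-sided limits everywhere, and the modification is its right limit.

    Two right-continuous versions agree a.s. at all rational times, hence at all
    times. If X has continuous paths, then the coordinates of the cadlag version
    are continuous by the same argument, so a left limit, which exists, can only
    be the value of the path (cadlag_version_continuous). *)

(** * Inner products and orthonormal expansions *)

Section inner_product.
Context {R : realType} {H : hilbertType R}.
Implicit Types (x y z : H) (c : R).

Lemma dotpC x y : dotp x y = dotp y x.
Proof. by have := hermC (@dotp R H) x y; rewrite expr0 mul1r. Qed.

Lemma dotpDl x y z : dotp (x + y) z = dotp x z + dotp y z.
Proof. exact: linearDl. Qed.

Lemma dotpBl x y z : dotp (x - y) z = dotp x z - dotp y z.
Proof. exact: linearBl. Qed.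

Lemma dotpZl c x z : dotp (c *: x) z = c * dotp x z.
Proof. exact: (@linearZl_LR _ _ _ _ _ _ (@dotp R H)). Qed.

Lemma dotp0l z : dotp 0 z = 0.
Proof. exact: linear0l. Qed.

Lemma dotp_suml I (r : seq I) (p : pred I) (F : I -> H) z :
  dotp (\sum_(i <- r | p i) F i) z = \sum_(i <- r | p i) dotp (F i) z.
Proof. exact: linear_sumlz. Qed.

Lemma dotpDr x y z : dotp z (x + y) = dotp z x + dotp z y.
Proof. by rewrite dotpC dotpDl !(dotpC z). Qed.

Lemma dotpBr x y z : dotp z (x - y) = dotp z x - dotp z y.
Proof. by rewrite dotpC dotpBl !(dotpC z). Qed.

Lemma dotpZr c x z : dotp z (c *: x) = c * dotp z x.
Proof. by rewrite dotpC dotpZl dotpC. Qed.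

Lemma dotp0r z : dotp z 0 = 0.
Proof. by rewrite dotpC dotp0l. Qed.

Lemma dotp_sumr I (r : seq I) (p : pred I) (F : I -> H) z :
  dotp z (\sum_(i <- r | p i) F i) = \sum_(i <- r | p i) dotp z (F i).
Proof. by rewrite dotpC dotp_suml; apply: eq_bigr => i _; rewrite dotpC. Qed.

Lemma normB_sqr x y : `|x - y| ^+ 2 = `|x| ^+ 2 - dotp x y *+ 2 + `|y| ^+ 2.
Proof. by rewrite -!dotpE dotpBl !dotpBr (dotpC y x); ring. Qed.

Lemma normD_sqr x y : `|x + y| ^+ 2 = `|x| ^+ 2 + dotp x y *+ 2 + `|y| ^+ 2.
Proof. by rewrite -!dotpE dotpDl !dotpDr (dotpC y x); ring. Qed.

Lemma cauchy_schwarz x y : `|dotp x y| <= `|x| * `|y|.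
Proof.
have [->|y0] := eqVneq y 0; first by rewrite dotp0r !normr0 mulr0.
have ny : 0 < `|y| by rewrite normr_gt0.
rewrite -(@ler_pXn2r _ 2)// ?nnegrE ?mulr_ge0// exprMn real_normK ?num_real//.
have := exprn_ge0 2 (normr_ge0 (`|y| ^+ 2 *: x - dotp x y *: y)).
rewrite normB_sqr dotpZl dotpZr !normrZ !exprMn !real_normK ?num_real//.
rewrite [X in 0 <= X](_ : _ =
  `|y| ^+ 2 * (`|x| ^+ 2 * `|y| ^+ 2 - dotp x y ^+ 2)); last by ring.
by rewrite pmulr_rge0 ?exprn_gt0// subr_ge0.
Qed.

Lemma cvg_dotpl (I : Type) (F : set_system I) {FF : Filter F}
    (u : I -> H) x y :
  u i @[i --> F] --> x -> dotp (u i) y @[i --> F] --> dotp x y.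
Proof.
move=> /cvgrPdist_lt ux; apply/cvgrPdist_lt => e e0.
have y0 : 0 < `|y| + 1 by rewrite ltr_wpDl.
have := ux _ (divr_gt0 e0 y0); apply: filterS => i ui.
rewrite -dotpBl (le_lt_trans (cauchy_schwarz _ _))//.
rewrite (@le_lt_trans _ _ (`|x - u i| * (`|y| + 1)))//.
  by rewrite ler_wpM2l// lerDl.
by rewrite -ltr_pdivlMr.
Qed.

Lemma dotp_ext x y : (forall z, dotp z x = dotp z y) -> x = y.
Proof.
move=> xy; apply/eqP; rewrite -subr_eq0 -normr_eq0 -sqrf_eq0 -dotpE.
by rewrite dotpBr xy subrr.
Qed.

End inner_product.

Section orthonormal_sequences.
Context {R : realType} {H : hilbertType R}.
Implicit Types (e : nat -> H) (c : nat -> R) (x y : H).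

(** Zero terms are allowed, so that a space of any finite dimension also has
    a total orthonormal sequence indexed by all of the natural numbers. *)
Definition orthonormal_seq e :=
  (forall i j, i != j -> dotp (e i) (e j) = 0) /\
  (forall i, e i = 0 \/ dotp (e i) (e i) = 1).

Definition total_seq e := forall x, (forall i, dotp x (e i) = 0) -> x = 0.

Definition fourier_sum c e n : H := \sum_(0 <= i < n) c i *: e i.

Lemma orthonormal_dotp_sum e c m n j : orthonormal_seq e ->
  dotp (\sum_(m <= i < n) c i *: e i) (e j) =
  if (m <= j < n)%N then c j * dotp (e j) (e j) else 0.
Proof.
move=> [oe _]; rewrite dotp_suml.
case: ifPn => mjn.
  rewrite (bigD1_seq j) ?mem_index_iota ?iota_uniq//= dotpZl big1 ?addr0//.
  by move=> i ij; rewrite dotpZl oe// mulr0.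
rewrite big_nat_cond big1 // => i; rewrite andbT => imn; rewrite dotpZl oe ?mulr0//.
by apply: contra mjn => /eqP <-.
Qed.

Lemma normr2_fourier_sum e c m n : orthonormal_seq e ->
  `|\sum_(m <= i < n) c i *: e i| ^+ 2 =
  \sum_(m <= i < n) c i ^+ 2 * dotp (e i) (e i).
Proof.
move=> oe; rewrite -dotpE dotp_sumr big_nat_cond [RHS]big_nat_cond.
apply: eq_bigr => i; rewrite andbT => imn.
by rewrite dotpZr orthonormal_dotp_sum// imn; ring.
Qed.

Lemma orthonormal_le1 e i : orthonormal_seq e -> 0 <= dotp (e i) (e i) <= 1.
Proof. by move=> [_ /(_ i)[->|->]]; rewrite ?dotp0l ?lexx ler01. Qed.

Lemma normr2_fourier_sum_le e c m n : orthonormal_seq e ->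
  `|\sum_(m <= i < n) c i *: e i| ^+ 2 <= \sum_(m <= i < n) c i ^+ 2.
Proof.
move=> oe; rewrite normr2_fourier_sum//; apply: ler_sum => i _.
have /andP[_] := orthonormal_le1 i oe.
by move=> ?; rewrite ler_piMr// sqr_ge0.
Qed.

Lemma dotp_orthonormal e x i : orthonormal_seq e ->
  dotp x (e i) * dotp (e i) (e i) = dotp x (e i).
Proof.
by move=> [_ /(_ i)[->|->]]; rewrite ?dotp0r ?mul0r ?mulr1.
Qed.

(** The difference of the two sides is the squared distance from x to its
    Fourier sum. *)
Lemma bessel e x n : orthonormal_seq e ->
  \sum_(0 <= i < n) dotp x (e i) ^+ 2 <= `|x| ^+ 2.
Proof.
move=> oe; rewrite -subr_ge0.
set s := fourier_sum (fun i => dotp x (e i)) e n.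
rewrite [X in 0 <= X](_ : _ = `|x - s| ^+ 2) ?exprn_ge0//.
rewrite normB_sqr dotp_sumr normr2_fourier_sum//.
under [X in _ = _ - X *+ 2 + _]eq_bigr do rewrite dotpZr -expr2.
under [X in _ = _ + X]eq_bigr do rewrite expr2 -mulrA dotp_orthonormal// -expr2.
by rewrite mulr2n; ring.
Qed.

Lemma cvg_fourier_sum e c (C : R) : orthonormal_seq e ->
  (forall n, \sum_(0 <= i < n) c i ^+ 2 <= C) -> cvgn (fourier_sum c e).
Proof.
move=> oe cC.
have cvgc : cvgn (series (fun i => c i ^+ 2)).
  apply: nondecreasing_is_cvgn.
    by apply/nondecreasing_seqP => n; rewrite seriesSr lerDl sqr_ge0.
  by exists C => _ [n _ <-]; exact: cC.
have /cauchy_seriesP cc : cauchy (series (fun i => c i ^+ 2) @ \oo) by exact: cvg_cauchy.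
apply: cauchy_cvg; apply/cauchy_seriesP => eps eps0.
have := cc _ (exprn_gt0 2 eps0); apply: filterS => -[m n] /= mn.
rewrite -(@ltr_pXn2r _ 2)// ?nnegrE//; last exact: ltW.
apply: le_lt_trans (normr2_fourier_sum_le _ _ _ oe) _.
by apply: le_lt_trans mn; exact: ler_norm.
Qed.

Lemma dotp_lim_fourier_sum e c x j : orthonormal_seq e ->
  fourier_sum c e @ \oo --> x -> dotp x (e j) = c j * dotp (e j) (e j).
Proof.
move=> oe cx.
have cxj : dotp (fourier_sum c e i) (e j) @[i --> \oo] --> dotp x (e j).
  exact: cvg_dotpl.
apply: (cvg_unique (@Rhausdorff R) cxj).
apply: cvg_near_cst; near=> n; rewrite orthonormal_dotp_sum//=.
by rewrite ifT//; near: n; exists j.+1.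
Unshelve. all: by end_near. Qed.

Lemma fourier_expansion e x : orthonormal_seq e -> total_seq e ->
  fourier_sum (fun i => dotp x (e i)) e @ \oo --> x.
Proof.
move=> oe te.
have cx := cvg_fourier_sum oe (fun n => bessel x n oe).
set y := lim (fourier_sum (fun i => dotp x (e i)) e @ \oo) in cx.
suff yx : y = x by rewrite -[X in _ --> X]yx; exact: cx.
apply/esym.
apply/eqP; rewrite -subr_eq0; apply/eqP/te => i.
by rewrite dotpBl (dotp_lim_fourier_sum i oe cx) dotp_orthonormal// subrr.
Qed.

Lemma parseval e x : orthonormal_seq e -> total_seq e ->
  (fun n => \sum_(0 <= i < n) dotp x (e i) ^+ 2) @ \oo --> `|x| ^+ 2.
Proof.
move=> oe te.
have : dotp (fourier_sum (fun i => dotp x (e i)) e n) x @[n --> \oo] --> dotp x x.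
  by apply: cvg_dotpl; exact: fourier_expansion.
rewrite dotpE.
apply: cvg_trans; apply: near_eq_cvg; apply: nearW => n.
by rewrite dotp_suml; apply: eq_bigr => i _; rewrite dotpZl expr2 (dotpC (e i)).
Qed.

End orthonormal_sequences.

Section orthonormal_bases.
Context {R : realType} {H : hilbertType R}.
Implicit Types (B : set H).

Lemma exists_orthonormal_basis : exists B : set H, orthonormal_basis B.
Proof.
have [F FO totF|B [oB maxB]] := @Zorn_bigcup H orthonormal_set.
  move=> e f [A FA Ae] [A' FA' A'f].
  have [/(_ _ Ae) A'e|/(_ _ A'f) Af] := totF _ _ FA FA'.
    exact: FO A'e A'f.
  exact: FO Ae Af.
exists B; split=> // x xB; apply: contrapT => /eqP x0.
have nx : `|x| != 0 by rewrite normr_eq0.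
pose y := `|x|^-1 *: x.
have yy : dotp y y = 1 by rewrite dotpZl dotpZr dotpE; field.
have yB e : B e -> dotp y e = 0 by move=> /xB; rewrite dotpZl => ->; rewrite mulr0.
have nBy : ~ B y.
  by move=> /yB; rewrite yy => /eqP; rewrite oner_eq0.
apply: (maxB (B `|` [set y])).
  split; first by move=> z Bz; left.
  by move=> /(_ y (or_intror erefl)).
move=> e f [Be|->] [Bf|->].
- exact: oB.
- rewrite dotpC yB//; case: eqP => // ey.
  by case: nBy; rewrite -ey.
- by rewrite yB//; case: eqP => // ey; case: nBy; rewrite ey.
- by rewrite yy eqxx.
Qed.

(** Distinct unit vectors of an orthonormal set are at distance sqrt 2, so
    balls of radius 1/2 around them hold distinct points of a dense set. *)
Lemma orthonormal_set_countable B : separable H -> orthonormal_set B ->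
  countable B.
Proof.
move=> [D /countable_injP[f finj] dD] oB.
have nearD (x : H) : exists y, D y /\ `|x - y| < 2^-1.
  have [] := dD (ball x 2^-1).
  - by exists x; apply: ballxx; rewrite invr_gt0.
  - exact: ball_open.
  - by move=> y []; rewrite -ball_normE /= => ? ?; exists y.
have [g gP] := choice nearD.
apply/countable_injP; exists (f \o g) => x y xB yB fgxy.
rewrite !inE in xB yB.
have gxy : g x = g y.
  by apply: finj fgxy; rewrite inE; [have [] := gP x|have [] := gP y].
apply: contrapT => /eqP xy.
have : `|x - y| < 1.
  have [_ gx] := gP x; have [_ gy] := gP y.
  rewrite -(subrK (g x) x) -addrA (le_lt_trans (ler_normD _ _))//.
  rewrite [ltRHS](_ : 1 = 2^-1 + 2^-1); last by field.
  by rewrite ltrD// gxy distrC.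
rewrite -(@ltr_pXn2r _ 2)// ?nnegrE// expr1n normB_sqr -!dotpE !oB//.
by rewrite !eqxx (negbTE xy) mul0rn subr0 gtrDl ltr10.
Qed.

(** Gaps in an enumeration of B are filled with 0. The last clause transports
    bounds on sums over finite parts of B to partial sums of the sequence. *)
Lemma orthonormal_basis_seq B : separable H -> orthonormal_basis B ->
  exists e : nat -> H, [/\ orthonormal_seq e, total_seq e &
    forall n, exists2 s : seq H, [set` s] `<=` B /\ uniq s &
      forall f : H -> R, f 0 = 0 ->
        \sum_(0 <= i < n) f (e i) = \sum_(x <- s) f x].
Proof.
move=> sH [oB tB]; have /countable_injP[g ginj] := orthonormal_set_countable sH oB.
pose e n := xget 0 [set x | B x /\ g x = n].
have eB n : e n = 0 \/ (B (e n) /\ g (e n) = n).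
  by rewrite /e; case: xgetP => [x _ []|]; [right|left].
have eg x : B x -> e (g x) = x.
  move=> Bx; rewrite /e; case: xgetP => [y _ [By gyx]|/(_ x)]; last by move/not_andP => [].
  by apply: ginj; rewrite ?inE.
exists e; split.
- split=> [i j ij|i].
    have [->|[Bi gi]] := eB i; first exact: dotp0l.
    have [->|[Bj gj]] := eB j; first exact: dotp0r.
    rewrite oB//; case: eqP => // eij; move: ij.
    by rewrite -gi -gj eij eqxx.
  have [->|[Bi gi]] := eB i; [by left|right].
  by rewrite oB// eqxx.
- by move=> x xe; apply: tB => y By; rewrite -(eg _ By).
- move=> n; exists [seq x <- [seq e i | i <- index_iota 0 n] | x != 0]; last first.
    move=> f f0; rewrite big_filter big_map [RHS]big_mkcond/=; apply: eq_bigr => i _.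
    by case: eqP => //= ->.
  split.
    move=> x /=; rewrite mem_filter => /andP[x0 /mapP[i _ xi]].
    by have [|[]] := eB i; rewrite -xi// => x0'; rewrite x0' eqxx in x0.
  rewrite filter_map map_inj_in_uniq ?filter_uniq ?iota_uniq//.
  move=> i j; rewrite !mem_filter /= => /andP[i0 _] /andP[j0 _] eij.
  have [ei|[Bi gi]] := eB i; first by rewrite ei eqxx in i0.
  have [ej|[Bj gj]] := eB j; first by rewrite ej eqxx in j0.
  by rewrite -gi -gj eij.
Qed.

End orthonormal_bases.

(** * The adjoint of a Hilbert-Schmidt operator *)

Section adjoint.
Context {R : realType} {H G : hilbertType R} (S : {linear H -> G}).

Lemma hilbert_schmidt_seq : separable H -> hilbert_schmidt S ->
  exists e : nat -> H, [/\ orthonormal_seq e, total_seq e &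
    exists C : R, forall n, \sum_(0 <= i < n) `|S (e i)| ^+ 2 <= C].
Proof.
move=> sH [_ [B onbB SB]].
have [e [oe te eB]] := orthonormal_basis_seq sH onbB.
exists e; split=> //; exists (fine (\esum_(x in B) (`|S x| ^+ 2)%:E)) => n.
have [s [sB us] es] := eB n.
rewrite (es (fun x => `|S x| ^+ 2)); last by rewrite raddf0 normr0 expr0n.
rewrite -lee_fin fineK; last first.
  rewrite ge0_fin_numE//; apply: esum_ge0 => x _.
  by rewrite lee_fin exprn_ge0.
apply: esum_ge; exists [set` s].
  by split; [exact: finite_seq|exact: sB].
by rewrite -sumEFin -fsbig_seq.
Qed.

Context (e : nat -> H) (C : R).
Hypotheses (cS : continuous S) (oe : orthonormal_seq e) (te : total_seq e).
Hypothesis SC : forall n, \sum_(0 <= i < n) `|S (e i)| ^+ 2 <= C.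

Let sum_dotp_le (g : G) n :
  \sum_(0 <= i < n) dotp (S (e i)) g ^+ 2 <= C * `|g| ^+ 2.
Proof.
apply: le_trans (ler_wpM2r (exprn_ge0 2 (normr_ge0 g)) (SC n)).
rewrite mulr_suml; apply: ler_sum => i _.
by rewrite -exprMn -[leLHS]real_normK ?num_real// lerXn2r ?nnegrE ?mulr_ge0//
  cauchy_schwarz.
Qed.

(** The vector representing h |-> <S h, g> is the sum of the orthogonal series
    with coefficients <S e_i, g>, which are square summable. *)
Lemma adjointP (g : G) (h : H) : dotp (S h) g = dotp h (adjoint S g).
Proof.
suff [a aP] : exists a, forall h, dotp (S h) g = dotp h a.
  by rewrite /adjoint; case: xgetP => [y _ yP|/(_ a)]; [exact: yP|].
have ca := cvg_fourier_sum oe (sum_dotp_le g).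
set a := lim (fourier_sum (fun i => dotp (S (e i)) g) e @ \oo) in ca.
exists a => {}h.
have h1 : dotp (S (fourier_sum (fun i => dotp h (e i)) e n)) g @[n --> \oo]
    --> dotp (S h) g.
  apply: cvg_dotpl; apply: (@cvg_comp _ _ _ _ S _ (nbhs h)).
    exact: fourier_expansion.
  exact: cS.
have h2 : dotp (fourier_sum (fun i => dotp (S (e i)) g) e n) h @[n --> \oo]
    --> dotp a h by apply: cvg_dotpl.
rewrite (dotpC h); apply: (cvg_unique (@Rhausdorff R) h1).
apply: cvg_trans h2; apply: near_eq_cvg; apply: nearW => n.
rewrite linear_sum !dotp_suml; apply: eq_bigr => i _.
by rewrite linearZ !dotpZl (dotpC h) mulrC.
Qed.

Lemma adjointZ c g : adjoint S (c *: g) = c *: adjoint S g.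
Proof. by apply: dotp_ext => h; rewrite dotpZr -!adjointP dotpZr. Qed.

Lemma adjointB g g' : adjoint S (g - g') = adjoint S g - adjoint S g'.
Proof. by apply: dotp_ext => h; rewrite dotpBr -!adjointP dotpBr. Qed.

Lemma adjoint_sum I (r : seq I) (F : I -> G) :
  adjoint S (\sum_(i <- r) F i) = \sum_(i <- r) adjoint S (F i).
Proof.
apply: dotp_ext => h; rewrite dotp_sumr -!adjointP dotp_sumr.
by apply: eq_bigr => i _; rewrite -!adjointP.
Qed.

Let cvg_adjoint g :
  (fun n => \sum_(0 <= i < n) dotp (S (e i)) g ^+ 2) @ \oo -->
    `|adjoint S g| ^+ 2.
Proof.
have := parseval (x := adjoint S g) oe te.
apply: cvg_trans; apply: near_eq_cvg; apply: nearW => n.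
by apply: eq_bigr => i _; rewrite dotpC -adjointP.
Qed.

Lemma normr2_adjoint_le g : `|adjoint S g| ^+ 2 <= C * `|g| ^+ 2.
Proof.
have ag := @cvg_adjoint g; rewrite -(cvg_lim (@Rhausdorff R) ag).
apply: limr_le; first by apply/cvg_ex; exists (`|adjoint S g| ^+ 2).
by apply: nearW => n; exact: sum_dotp_le.
Qed.

Lemma cvg_adjoint_fourier (f : nat -> G) g :
  orthonormal_seq f -> total_seq f ->
  fourier_sum (fun j => dotp g (f j)) (adjoint S \o f) @ \oo --> adjoint S g.
Proof.
move=> onf tf; apply/cvgrPdist_lt => eps eps0.
have C0 : 0 < C + 1.
  by rewrite ltr_wpDl// (le_trans _ (SC 0))// big_geq.
have /cvgrPdist_lt/(_ _ (divr_gt0 eps0 C0)) := fourier_expansion (x := g) onf tf.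
apply: filterS => n; rewrite ltr_pdivlMr// => gn.
rewrite /fourier_sum /=; under eq_bigr do rewrite -adjointZ.
rewrite -adjoint_sum -adjointB -(@ltr_pXn2r _ 2)// ?nnegrE//; last exact: ltW.
apply: le_lt_trans (normr2_adjoint_le _) _.
apply: (@le_lt_trans _ _ ((`|g - fourier_sum (fun j => dotp g (f j)) f n| * (C + 1)) ^+ 2)).
  rewrite exprMn mulrC ler_wpM2l ?exprn_ge0//.
  nra.
rewrite ltr_pXn2r// ?nnegrE; [exact: mulr_ge0 (normr_ge0 _) (ltW C0)|exact: ltW].
Qed.

(** Summing the squares of the matrix coefficients <S e_i, f_j> over j first
    or over i first gives the same Hilbert-Schmidt norm. *)
Lemma sum_normr2_adjoint_le (f : nat -> G) n : orthonormal_seq f ->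
  \sum_(0 <= j < n) `|adjoint S (f j)| ^+ 2 <= C.
Proof.
move=> onf.
have h : (fun m => \sum_(0 <= j < n) \sum_(0 <= i < m) dotp (S (e i)) (f j) ^+ 2)
    @ \oo --> \sum_(0 <= j < n) `|adjoint S (f j)| ^+ 2.
  apply: cvg_big => [|j _]; last exact: cvg_adjoint.
  exact: add_continuous.
rewrite -(cvg_lim (@Rhausdorff R) h).
apply: limr_le.
  by apply/cvg_ex; exists (\sum_(0 <= j < n) `|adjoint S (f j)| ^+ 2).
apply: nearW => m; rewrite exchange_big/=; apply: le_trans (SC m).
by apply: ler_sum => i _; exact: bessel.
Qed.

End adjoint.

(** * Averages over random signs *)

Section sign_average.
Context {R : realType}.

(** The mean of f (x + sum_i s_i y_i) over all choices of signs s_i, where the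
    y_i are the entries of s. The recursion on s turns every moment computation
    into an induction. *)
Fixpoint sign_mean (V : zmodType) (f : V -> R) (s : seq V) (x : V) : R :=
  if s is y :: s' then (sign_mean f s' (x + y) + sign_mean f s' (x - y)) / 2
  else f x.

Lemma sign_mean_ge0 (V : zmodType) (f : V -> R) s x :
  (forall y, 0 <= f y) -> 0 <= sign_mean f s x.
Proof.
move=> f0; elim: s x => //= y s IH x.
by rewrite divr_ge0// addr_ge0.
Qed.

Lemma ler_sign_mean (V : zmodType) (f g : V -> R) s x :
  (forall y, f y <= g y) -> sign_mean f s x <= sign_mean g s x.
Proof.
move=> fg; elim: s x => //= y s IH x.
by rewrite ler_pM2r ?invr_gt0// lerD.
Qed.

Lemma sign_mean_affine (V : zmodType) (f g : V -> R) (a b c : R) s x :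
  sign_mean (fun y => a * f y + b * g y + c) s x =
  a * sign_mean f s x + b * sign_mean g s x + c.
Proof. by elim: s x => //= y s IH x; rewrite !IH; field. Qed.

Lemma sign_mean_sqr (s : seq R) x :
  sign_mean (fun u : R => u ^+ 2) s x = x ^+ 2 + \sum_(y <- s) y ^+ 2.
Proof.
elim: s x => [|y s IH] x /=; first by rewrite big_nil addr0.
by rewrite !IH big_cons; field.
Qed.

Lemma sign_mean_pow4_le (s : seq R) x : let v := \sum_(y <- s) y ^+ 2 in
  sign_mean (fun u : R => u ^+ 4) s x <= x ^+ 4 + 6 * x ^+ 2 * v + 3 * v ^+ 2.
Proof.
elim: s x => [|y s IH] x /=.
  by rewrite big_nil mulr0 expr0n/= mulr0 !addr0.
rewrite big_cons; set v := \sum_(_ <- _) _ in IH *.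
rewrite ler_pdivrMr//; apply: le_trans (lerD (IH _) (IH _)) _.
rewrite -subr_ge0 [X in 0 <= X](_ : _ = 4 * (y ^+ 2) ^+ 2); last by ring.
by rewrite mulr_ge0// sqr_ge0.
Qed.

(** The Paley-Zygmund inequality for sums of random signs. With v the sum of
    the squares, (u^2 - v/2)(10v - u^2) is at most 23v^2 and is negative
    when |u| < eps; by the second and fourth moments its mean is at least
    (21/2 - 3 - 5)v^2, and (5/2)/23 > 1/10. *)
Lemma sign_mean_large (s : seq R) (eps : R) : 0 < eps ->
  2 * eps ^+ 2 <= \sum_(y <- s) y ^+ 2 ->
  10^-1 <= sign_mean (fun u : R => (eps <= `|u|)%R%:R) s 0.
Proof.
move=> eps0; set v := \sum_(_ <- _) _ => ev.
have v0 : 0 < v by apply: lt_le_trans ev; rewrite mulr_gt0// exprn_gt0.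
have h u : (21 / 2 * v) * u ^+ 2 + (-1) * u ^+ 4 + (- 5 * v ^+ 2) <=
    (23 * v ^+ 2) * (eps <= `|u|)%R%:R + 0 * 0 + 0.
  rewrite [leLHS](_ : _ = (u ^+ 2 - v / 2) * (10 * v - u ^+ 2)); last by field.
  rewrite mulr0 !addr0; case: (leP eps `|u|) => eu; last first.
    have : u ^+ 2 < eps ^+ 2.
      by rewrite -[ltLHS]real_normK ?num_real// ltr_pXn2r// ?nnegrE ?ltW.
    by move=> ?; rewrite mulr0; nra.
  rewrite mulr1; have := sqr_ge0 (u ^+ 2 - 21 / 4 * v); nra.
have := ler_sign_mean s 0 h.
rewrite (sign_mean_affine (fun u : R => u ^+ 2) (fun u => u ^+ 4)).
rewrite (sign_mean_affine (fun u : R => (eps <= `|u|)%R%:R) (fun u => 0)).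
rewrite sign_mean_sqr -/v; have := sign_mean_pow4_le s 0; rewrite /= -/v.
set m4 := sign_mean _ _ _; set m := sign_mean _ _ _ => m4v mv.
rewrite -(@ler_pM2l _ (23 * v ^+ 2)) ?mulr_gt0 ?exprn_gt0//.
have : 0 < v ^+ 2 by rewrite exprn_gt0.
by move=> ?; lra.
Qed.

End sign_average.

(** * Square summability of a continuous cylindrical random variable *)

Section radonification.
Context {d} {T : measurableType d} {R : realType} {P : probability T R}.
Context {H : hilbertType R} (X : {linear H -> L0 P}).
Local Open Scope ereal_scope.

Lemma measurable_sign_mean (f : R -> R) (s : seq H) (u : T -> R) :
  measurable_fun setT f -> measurable_fun setT u ->
  measurable_fun setT
    (fun w => sign_mean f [seq (X a : L0 P) w | a <- s] (u w)).
Proof.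
move=> mf; elim: s u => [|a s IH] u mu /=.
  exact: measurableT_comp.
apply: measurable_funM; last exact: measurable_cst.
by apply: measurable_funD; apply: IH; [apply: measurable_funD|apply: measurable_funB];
  rewrite //; exact: measurable_L0.
Qed.

Lemma measurable_norm_ge (eps : R) :
  measurable_fun setT (fun u : R => (eps <= `|u|)%R%:R : R).
Proof.
rewrite (_ : (fun _ => _) = \1_[set u | (eps <= `|u|)%R]); last first.
  by apply/funext => u; rewrite indicE mem_setE.
apply: measurable_indic; rewrite -[X in measurable X]setTI.
by apply: measurable_fun_le => //; exact: measurable_cst.
Qed.

Lemma ae_eq_measurable_set (A B : set T) : measurable A -> measurable B ->
  {ae P, forall w, A w <-> B w} -> P A = P B.
Proof.
move=> mA mB AB.
have -> : P A = \int[P]_w (\1_A w)%:E by rewrite integral_indic// setIT.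
have -> : P B = \int[P]_w (\1_B w)%:E by rewrite integral_indic// setIT.
apply: ae_eq_integral => //; try by apply/measurable_EFinP; exact: measurable_indic.
apply: filterS AB => w AB _; rewrite !indicE.
by have -> : (w \in A) = (w \in B) by apply/idP/idP; rewrite !inE => /AB.
Qed.

(** By the parallelogram identity, averaging over one more sign adds the square
    of the norm of the corresponding vector to the bound. *)
Lemma integral_sign_mean_le (s : seq H) (h : H) (eps c K : R) :
  (forall h, P [set w | (eps <= `|(X h : L0 P) w|)%R] <= (c + K * `|h| ^+ 2)%:E) ->
  \int[P]_w (sign_mean (fun u : R => (eps <= `|u|)%R%:R)
    [seq (X a : L0 P) w | a <- s] ((X h : L0 P) w))%:E <=
  (c + K * (`|h| ^+ 2 + \sum_(a <- s) `|a| ^+ 2))%:E.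
Proof.
move=> XK; set f := fun u : R => _.
have mf : measurable_fun setT f := measurable_norm_ge eps.
have f0 u : (0 <= f u)%R by [].
elim: s h => [|a s IH] h.
  rewrite big_nil addr0; apply: le_trans (XK h); rewrite le_eqVlt; apply/orP; left.
  rewrite /= -[X in _ == P X]setIT -integral_indic//; last first.
    rewrite -[X in measurable X]setTI.
    apply: measurable_fun_le => //.
    by apply: measurableT_comp => //; exact: measurable_L0.
  apply/eqP/eq_integral => w _; rewrite indicE /f mem_setE.
  by [].
rewrite /= (ae_eq_integral (fun w =>
  2^-1%:E * ((sign_mean f [seq (X a : L0 P) w | a <- s] ((X (h + a) : L0 P) w))%:E +
  (sign_mean f [seq (X a : L0 P) w | a <- s] ((X (h - a) : L0 P) w))%:E)))//.
- rewrite ge0_integralZl//; last 2 first.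
  + apply: emeasurable_funD; apply/measurable_EFinP; apply: measurable_sign_mean => //; exact: measurable_L0.
  + by move=> w _; rewrite adde_ge0// lee_fin sign_mean_ge0.
  rewrite ge0_integralD//; last 4 first.
  + by move=> w _; rewrite lee_fin sign_mean_ge0.
  + by apply/measurable_EFinP; apply: measurable_sign_mean => //; exact: measurable_L0.
  + by move=> w _; rewrite lee_fin sign_mean_ge0.
  + by apply/measurable_EFinP; apply: measurable_sign_mean => //; exact: measurable_L0.
  rewrite -lee_pdivlMl//.
  apply: le_trans (leeD (IH _) (IH _)) _; rewrite -EFinD -EFinM lee_fin big_cons.
  by rewrite normD_sqr normB_sqr; lra.
- apply/measurable_EFinP.
  apply: (@measurable_sign_mean f (a :: s) (X h : L0 P)) => //; exact: measurable_L0.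
- apply: measurable_funeM; apply: emeasurable_funD; apply/measurable_EFinP; apply: measurable_sign_mean => //; exact: measurable_L0.
- have := L0_DE (X h) (X a); rewrite -linearD => hD.
  have := L0_DE (X h) (- X a)%R; rewrite -linearB => hB.
  have hN := L0_NE (X a).
  near=> w => _.
  rewrite (near hD w)// (near hB w)// (near hN w)//.
  by rewrite -EFinD -EFinM mulrC.
Unshelve. all: by end_near. Qed.

(** The images of the signed sums of s are small with large probability on
    average over the signs; by the Paley-Zygmund inequality, so is the sum of
    the squares of the images of the entries of s. *)
Lemma prob_sum_sqr_le (s : seq H) (eps c K : R) : (0 < eps)%R ->
  (forall h, P [set w | (eps <= `|(X h : L0 P) w|)%R] <= (c + K * `|h| ^+ 2)%:E) ->
  P [set w | (2 * eps ^+ 2 <= \sum_(a <- s) (X a : L0 P) w ^+ 2)%R] <=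
  (10 * (c + K * \sum_(a <- s) `|a| ^+ 2))%:E.
Proof.
move=> eps0 XK.
set A := [set w | _].
have mA : measurable A.
  rewrite -[X in measurable X]setTI; apply: measurable_fun_le => //.
  apply: measurable_sum => a; apply: measurable_funX; exact: measurable_L0.
pose F w : R := sign_mean (fun u : R => (eps <= `|u|)%R%:R)
  [seq (X a : L0 P) w | a <- s] ((X 0%R : L0 P) w).
have XF : \int[P]_w (F w)%:E <= (c + K * \sum_(a <- s) `|a| ^+ 2)%:E.
  by have := @integral_sign_mean_le s 0%R _ _ _ XK; rewrite normr0 expr0n add0r.
have mF : measurable_fun setT F.
  apply: measurable_sign_mean; first exact: measurable_norm_ge.
  exact: measurable_L0.
have F0 w : (0 <= F w)%R by exact: sign_mean_ge0.
apply: (@le_trans _ _ (\int[P]_w (10%:E * (F w)%:E))); last first.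
  rewrite ge0_integralZl//; [|exact/measurable_EFinP|by move=> w _; rewrite lee_fin].
  by rewrite EFinM lee_pmul2l.
rewrite -[X in P X]setIT -integral_indic//.
apply: ae_ge0_le_integral => //.
- by apply/measurable_EFinP; exact: measurable_indic.
- by move=> w _; rewrite mule_ge0// lee_fin.
- by apply: measurable_funeM; exact/measurable_EFinP.
- have := L0_0E P; rewrite -(linear0 X); apply: filterS => w w0 _.
  rewrite indicE -EFinM lee_fin; case: (boolP (w \in A)) => [|_]; last first.
    by rewrite mulr_ge0.
  rewrite inE /A/= => Aw; rewrite -ler_pdivrMl// mulr1 /F w0.
  by apply: sign_mean_large; rewrite // big_map.
Qed.

End radonification.

(** * Equicontinuity in probability *)

Section equicontinuity.
Context {d} {T : measurableType d} {R : realType} {P : probability T R}.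
Context {H : hilbertType R}.
Local Open Scope ereal_scope.

Lemma measurable_abs_ge (u : T -> R) (r : R) : measurable_fun setT u ->
  measurable [set w | (r <= `|u w|)%R].
Proof.
move=> mu; rewrite -[X in measurable X]setTI.
by apply: measurable_fun_le => //; apply: measurableT_comp.
Qed.

Lemma prob_abs_le_add (u v : T -> R) (r s : R) :
  measurable_fun setT u -> measurable_fun setT v ->
  P [set w | (r + s <= `|u w|)%R] <=
  P [set w | (r <= `|v w|)%R] + P [set w | (s <= `|u w - v w|)%R].
Proof.
move=> mu mv.
have m1 := measurable_abs_ge r mv.
have m2 : measurable [set w | (s <= `|u w - v w|)%R].
  by apply: (@measurable_abs_ge (fun w => u w - v w)%R); exact: measurable_funB.
apply: le_trans (measureU2 _ m1 m2).
apply: le_measure; rewrite ?inE; [exact: measurable_abs_ge|exact: measurableU|].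
move=> w /= rs; apply/orP; rewrite -implyNb -ltNge; apply/implyP => vr.
rewrite leNgt; apply/negP => uvs; move: rs; apply/negP; rewrite -ltNge.
by rewrite -[u w](subrKC (v w)) (le_lt_trans (ler_normD _ _))// ltrD.
Qed.

(** Baire's theorem: H is the union over n of the closed sets of those h that
    satisfy P(|X_t h| >= n + r) <= c/4 + r for all t <= 1/n and r > 0, so one of
    them has an inner point h0. Subtracting h0 and rescaling moves the bound to
    a neighbourhood of 0. The slack r makes the complements visibly open. *)
Lemma equicontinuous_at0 (X : R -> {linear H -> L0 P}) :
  (forall t, (0 <= t)%R -> continuous (X t)) ->
  (forall h (c : R), (0 < c)%R -> exists2 n : nat, (0 < n)%N &
    forall t, (0 <= t <= n%:R^-1)%R ->
      P [set w | (n%:R <= `|(X t h : L0 P) w|)%R] <= c%:E) ->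
  forall c eps : R, (0 < c)%R -> (0 < eps)%R ->
  exists2 delta : R, (0 < delta)%R & exists2 K : R, (0 <= K)%R &
    forall t, (0 <= t <= delta)%R -> forall h,
      P [set w | (eps <= `|(X t h : L0 P) w|)%R] <= (c + K * `|h| ^+ 2)%:E.
Proof.
move=> cX bX c eps c0 eps0.
have mX t h : measurable_fun setT (X t h : L0 P) by exact: measurable_L0.
pose c4 := (c / 4)%R; have c40 : (0 < c4)%R by rewrite divr_gt0.
pose O (n : nat) := [set h | exists t, (0 <= t <= n.+1%:R^-1)%R /\
  exists2 r : R, (0 < r)%R &
    (c4 + r)%:E < P [set w | (n.+1%:R + r <= `|(X t h : L0 P) w|)%R]].
have oO n : open (O n).
  rewrite openE => h [t [tn [r r0 cr]]].
  have t0 : (0 <= t)%R by case/andP: tn.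
  have r20 : (0 < r / 2)%R by rewrite divr_gt0.
  have hb : \forall h' \near h, ball (X t h) (r / 2)%R (X t h').
    exact: cX t t0 h (ball (X t h) (r / 2)) (nbhsx_ballx _ _ r20).
  apply: filterS hb => h' hh'; exists t; split=> //.
  exists (r / 2)%R => //.
  have := prob_abs_le_add (n.+1%:R + r / 2) (r / 2) (mX t h) (mX t h').
  rewrite -addrA -splitr => /(lt_le_trans cr) cr'.
  rewrite -(@lteD2rE _ (r / 2)%:E)// -EFinD -addrA -splitr.
  apply: lt_le_trans cr' _; rewrite leeD2l//; exact: ltW.
have [n nO] : exists n, ~ dense (O n).
  apply: contrapT => /forallNP dO.
  have dI : dense (\bigcap_n O n).
    by apply: Baire => n; split; [exact: oO|exact: contrapT (dO n)].
  have [|h [_ hO]] := dI setT _ openT; first by exists 0%R.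
  have [[//|n] _ nh] := bX h _ c40.
  have [t [tn [r r0]]] := hO n I; apply/negP; rewrite -leNgt.
  apply: (@le_trans _ _ c4%:E); last by rewrite lee_fin lerDl ltW.
  apply: le_trans (nh t tn).
  apply: le_measure; rewrite ?inE; try exact: measurable_abs_ge.
  by move=> w /=; apply: le_trans; rewrite lerDl ltW.
have [D [[h0 [oD Dh0]]]] := denseNE nO; move/disjoints_subset => DO.
have [rho /= rho0 rhoD] : exists2 rho : R, (0 < rho)%R & ball h0 rho `<=` D.
  by apply/nbhs_ballP; apply/open_nbhs_nbhs.
pose M := (n.+1%:R + c4)%R.
have nOM h t : D h -> (0 <= t <= n.+1%:R^-1)%R ->
    P [set w | (M <= `|(X t h : L0 P) w|)%R] <= (c4 + c4)%:E.
  move=> Dh tn; rewrite leNgt; apply/negP => ltM.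
  by apply: (DO h Dh); exists t; split=> //; exists c4.
have small h t : (`|h| < rho)%R -> (0 <= t <= n.+1%:R^-1)%R ->
    P [set w | (M + M <= `|(X t h : L0 P) w|)%R] <= c%:E.
  move=> hrho tn.
  have Dh : D (h0 + h)%R.
    by apply: rhoD; rewrite -ball_normE/= opprD addrA subrr sub0r normrN.
  apply: le_trans (prob_abs_le_add M M (mX t h) (mX t (h0 + h)%R)) _.
  have -> : P [set w | (M <= `|(X t h : L0 P) w - (X t (h0 + h) : L0 P) w|)%R] =
      P [set w | (M <= `|(X t h0 : L0 P) w|)%R].
    apply: ae_eq_measurable_set.
    - apply: (@measurable_abs_ge (fun w => (X t h : L0 P) w -
        (X t (h0 + h) : L0 P) w)%R).
      exact: measurable_funB.
    - exact: measurable_abs_ge.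
    - have := L0_DE (X t h0) (X t h); rewrite -linearD; apply: filterS => w /= ->.
      by rewrite opprD addrCA subrr addr0 normrN.
  apply: le_trans (leeD (nOM _ _ Dh tn) (nOM _ _ Dh0 tn)) _.
  by rewrite -EFinD lee_fin /c4; lra.
exists n.+1%:R^-1%R; first by rewrite invr_gt0.
have M0 : (0 < M)%R by rewrite addr_gt0.
pose s := ((M + M) / eps)%R.
have s0 : (0 < s)%R by rewrite divr_gt0// addr_gt0.
exists ((s / rho) ^+ 2)%R; first by rewrite sqr_ge0.
move=> t tn h; have [sh|sh] := ltP (`|s *: h|)%R rho.
  rewrite (@ae_eq_measurable_set _ _ _ _ _
    [set w | (M + M <= `|(X t (s *: h) : L0 P) w|)%R]).
  - apply: le_trans (small _ _ sh tn) _.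
    by rewrite lee_fin lerDl mulr_ge0 ?sqr_ge0.
  - exact: measurable_abs_ge.
  - exact: measurable_abs_ge.
  - have := L0_ZE s (X t h); rewrite -linearZ/=; apply: filterS => w /= ->.
    rewrite normrM gtr0_norm// -ler_pdivrMl// /s invf_div.
    by rewrite divfK// gt_eqF// addr_gt0.
apply: le_trans (probability_le1 _ _) _; first exact: measurable_abs_ge.
rewrite lee_fin; apply: ler_wpDl; first exact: ltW.
have sr0 : (0 <= s / rho)%R by rewrite divr_ge0 ?ltW.
rewrite -exprMn -[leLHS](expr1n _ 2) lerXn2r ?nnegrE//; first exact: mulr_ge0.
by rewrite mulrAC ler_pdivlMr// mul1r (le_trans sh)// normrZ gtr0_norm.
Qed.

(** Near 0 the bound is c by continuity; away from 0 the quadratic term exceeds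
    1. *)
Lemma continuous_L0_bound (X : {linear H -> L0 P}) : continuous X ->
  forall c eps : R, (0 < c)%R -> (0 < eps)%R ->
  exists2 K : R, (0 <= K)%R & forall h,
    P [set w | (eps <= `|(X h : L0 P) w|)%R] <= (c + K * `|h| ^+ 2)%:E.
Proof.
move=> cX c eps c0 eps0.
have m0 : (0 < Num.min eps c)%R by rewrite lt_min eps0.
have /nbhs_ballP[rho /= rho0 rhoX] :=
  cX 0%R (ball (X 0%R) (Num.min eps c)) (nbhsx_ballx _ _ m0).
exists (rho^-1 ^+ 2)%R; first by rewrite sqr_ge0.
have mX h : measurable_fun setT (X h : L0 P) by exact: measurable_L0.
move=> h; have [hrho|hrho] := ltP `|h|%R rho; last first.
  apply: le_trans (probability_le1 _ _) _; first exact: measurable_abs_ge.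
  rewrite lee_fin; apply: ler_wpDl; first exact: ltW.
  rewrite -exprMn -[leLHS](expr1n _ 2) lerXn2r ?nnegrE//; first by rewrite mulr_ge0// invr_ge0 ltW.
  by rewrite ler_pdivlMl// mulr1.
have /ltW : (P [set w | (Num.min eps c <= `|(X 0%R : L0 P) w - (X h : L0 P) w|)%R]
    < (Num.min eps c)%:E).
  by apply: rhoX; rewrite -ball_normE/= sub0r normrN.
rewrite (@ae_eq_measurable_set _ _ _ _ _
    [set w | (Num.min eps c <= `|(X h : L0 P) w|)%R]).
- move=> hX; apply: (@le_trans _ _ c%:E); last by rewrite lee_fin lerDl mulr_ge0 ?sqr_ge0.
  apply: (@le_trans _ _ (Num.min eps c)%:E); last by rewrite lee_fin ge_min lexx orbT.
  apply: le_trans hX; apply: le_measure; rewrite ?inE; try exact: measurable_abs_ge.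
  by move=> w /=; apply: le_trans; rewrite ge_min lexx.
- by apply: (@measurable_abs_ge (fun w => (X 0 : L0 P) w - (X h : L0 P) w)%R); exact: measurable_funB.
- exact: measurable_abs_ge.
- have := L0_0E P; rewrite -(linear0 X); apply: filterS => w /= ->.
  by rewrite sub0r normrN.
Qed.

End equicontinuity.

(** * Null sets and limits *)

Section null_sets.
Context {d} {T : measurableType d} {R : realType} {P : probability T R}.
Local Open Scope ereal_scope.

(** The limit inferior of a sequence of events. *)
Definition eventually_in (A : nat -> set T) : set T :=
  \bigcup_N \bigcap_(n in [set n | (N <= n)%N]) A n.

Lemma measurable_eventually_in (A : nat -> set T) :
  (forall n, measurable (A n)) -> measurable (eventually_in A).
Proof.
move=> mA; apply: bigcupT_measurable => N; apply: bigcap_measurableType => n _.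
exact: mA.
Qed.

(** Fatou's lemma for events. *)
Lemma prob_eventually_in_le (A : nat -> set T) (c : \bar R) :
  (forall n, measurable (A n)) -> (\forall n \near \oo, P (A n) <= c) ->
  P (eventually_in A) <= c.
Proof.
move=> mA [N0 _ Ac].
pose F N := \bigcap_(n in [set n | (N <= n)%N]) A n.
have mF N : measurable (F N) by apply: bigcap_measurableType => n _; exact: mA.
have ndF : nondecreasing_seq F.
  by move=> m n mn; apply/subsetPset => w Fw k /= nk; apply: Fw; exact: leq_trans mn nk.
have cF := nondecreasing_cvg_mu mF (bigcupT_measurable _ mF) ndF.
rewrite -(cvg_lim (@ereal_hausdorff R) (cF _ P)).
apply: lime_le; first by apply/cvg_ex; exists (P (\bigcup_N F N)); exact: (cF _ P).
apply: nearW => N; apply: le_trans (Ac (maxn N N0) _); last exact: leq_maxr.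
by apply: le_measure; rewrite ?inE// => w; apply; exact: leq_maxl.
Qed.

Lemma ae_of_small (Q : T -> Prop) :
  (forall c : R, (0 < c)%R -> exists A, [/\ measurable A, P A <= c%:E &
    forall w, ~ Q w -> A w]) -> {ae P, forall w, Q w}.
Proof.
move=> Qc.
have pos n : (0 < n.+1%:R^-1 :> R)%R by rewrite invr_gt0.
have [A AP] := choice (fun n => Qc _ (pos n)).
exists (\bigcap_n A n); split.
- by apply: bigcap_measurableType => n _; have [] := AP n.
- apply/eqP; rewrite eq_le measure_ge0 andbT; apply/lee_addgt0Pr => e e0.
  rewrite add0e.
  have [n _ /(_ n (leqnn n)) ne] := near_infty_natSinv_lt (PosNum e0).
  have [mAn An _] := AP n.
  apply: (@le_trans _ _ (P (A n))).
    apply: le_measure; rewrite ?inE//; last exact: bigcap_inf.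
    by apply: bigcap_measurableType => k _; have [] := AP k.
  by apply: le_trans An _; rewrite lee_fin ltW.
- by move=> w nQ n _; have [_ _] := AP n; exact.
Qed.

(** Where |v| exceeds 1/k, eventually |u_n| does so too; by Fatou's lemma, this
    happens with probability 0. *)
Lemma ae_eq0_of_cvg_prob (u : nat -> T -> R) (v : T -> R) :
  (forall n, measurable_fun setT (u n)) ->
  (forall e : R, (0 < e)%R -> P [set w | (e <= `|u n w|)%R] @[n --> \oo] --> 0) ->
  {ae P, forall w, u n w @[n --> \oo] --> v w} ->
  {ae P, forall w, v w = 0%R}.
Proof.
move=> mu u0 uv.
have vk (k : nat) : {ae P, forall w, (u n w @[n --> \oo] --> v w) ->
    (`|v w| <= k.+1%:R^-1)%R}.
  have k0 : (0 < k.+1%:R^-1 :> R)%R by rewrite invr_gt0.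
  apply: ae_of_small => c c0.
  exists (eventually_in (fun n => [set w | (k.+1%:R^-1 <= `|u n w|)%R])).
  have mA n : measurable [set w | (k.+1%:R^-1 <= `|u n w|)%R].
    by apply: measurable_abs_ge; exact: mu.
  split; [exact: measurable_eventually_in| |].
  - apply: prob_eventually_in_le => //.
    have /fine_cvgP[fu /cvgrPdist_lt/(_ _ c0) uc] := u0 _ k0.
    near=> n.
    have : (`|0 - fine (P [set w | (k.+1%:R^-1 <= `|u n w|)%R])| < c)%R.
      by near: n; exact: uc.
    rewrite sub0r normrN => /ltW /(le_trans (ler_norm _)).
    by rewrite -lee_fin fineK//; near: n.
  - move=> w /not_implyP[uvw /negP]; rewrite -ltNge => kv.
    have /cvgrPdist_lt/(_ (`|v w| - k.+1%:R^-1)%R) := uvw.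
    rewrite subr_gt0 => /(_ kv)[N _ Nu]; exists N => // n /= Nn.
    have := Nu n Nn; rewrite ltrBrDr -ltrBrDl => un.
    apply: ltW; apply: lt_le_trans un _; rewrite lerBlDr.
    by rewrite -{1}(subrK (u n w) (v w)) addrC ler_normD.
have := ae_foralln vk; apply: filter_app; apply: filterS uv => w uvw vkw.
apply/eqP; rewrite -normr_le0; apply/ler_addgt0Pr => e e0; rewrite add0r.
have [n _ /(_ n (leqnn n)) ne] := near_infty_natSinv_lt (PosNum e0).
by apply: le_trans (vkw n uvw) _; exact: ltW.
Unshelve. all: by end_near. Qed.

End null_sets.

(** * The value at a fixed time *)

Section fixed_time.
Context {d} {T : measurableType d} {R : realType} {P : probability T R}.
Context {H G : hilbertType R}.
Local Open Scope ereal_scope.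

Lemma scaled_L0_bound (X : {linear H -> L0 P}) (c K : R) :
  (forall h, P [set w | (1 <= `|(X h : L0 P) w|)%R] <= (c + K * `|h| ^+ 2)%:E) ->
  forall eps : R, (0 < eps)%R -> forall h,
    P [set w | (eps <= `|(X h : L0 P) w|)%R] <=
    (c + K / eps ^+ 2 * `|h| ^+ 2)%:E.
Proof.
move=> XK eps eps0 h; have := XK (eps^-1 *: h).
rewrite normrZ gtr0_norm ?invr_gt0// exprMn exprVn mulrA.
congr (_ <= _); apply: ae_eq_measurable_set.
- by apply: measurable_abs_ge; exact: measurable_L0.
- by apply: measurable_abs_ge; exact: measurable_L0.
- have := L0_ZE eps^-1%R (X h); rewrite -linearZ/=; apply: filterS => w /= ->.
  by rewrite normrM gtr0_norm ?invr_gt0// ler_pdivlMl// mulr1.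
Qed.

(** The partial sums increase, so a bound in probability that is uniform in n
    makes them bounded almost surely. *)
Lemma sum_sqr_bounded (X : {linear H -> L0 P}) (a : nat -> H) (C : R) :
  continuous X -> (forall n, (\sum_(0 <= i < n) `|a i| ^+ 2 <= C)%R) ->
  {ae P, forall w, exists M : R, forall n,
    (\sum_(0 <= i < n) (X (a i) : L0 P) w ^+ 2 <= M)%R}.
Proof.
move=> cX aC; apply: ae_of_small => c c0.
(* prob_sum_sqr_le will return 10 (c / 20 + c / 20) = c *)
have c200 : (0 < c / 20)%R by rewrite divr_gt0.
have [K K0 /scaled_L0_bound XK] := continuous_L0_bound cX c200 (@ltr01 R).
have C0 : (0 <= C)%R by apply: le_trans (aC 0%N); rewrite big_geq.
pose eps := Num.sqrt (K * C / (c / 20) + 1)%R.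
have eps2 : (eps ^+ 2 = K * C / (c / 20) + 1)%R.
  by rewrite sqr_sqrtr// addr_ge0// divr_ge0// ?mulr_ge0// ltW.
have eps0 : (0 < eps)%R.
  by rewrite sqrtr_gt0 ltr_wpDl// divr_ge0// ?mulr_ge0// ltW.
pose A n := [set w | (2 * eps ^+ 2 <= \sum_(0 <= i < n) (X (a i) : L0 P) w ^+ 2)%R].
have mA n : measurable (A n).
  rewrite -[X in measurable X]setTI; apply: measurable_fun_le => //.
  apply: measurable_sum => i; apply: measurable_funX; exact: measurable_L0.
exists (eventually_in A); split; first exact: measurable_eventually_in.
- apply: prob_eventually_in_le => //; apply: nearW => n.
  have := prob_sum_sqr_le (map a (index_iota 0 n)) eps0 (XK eps eps0).
  rewrite /A; under eq_set do rewrite big_map; rewrite big_map => /le_trans; apply.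
  rewrite lee_fin.
  have : (K / eps ^+ 2 * \sum_(0 <= i < n) `|a i| ^+ 2 <= c / 20)%R.
    rewrite mulrAC ler_pdivrMr ?exprn_gt0//.
    apply: (@le_trans _ _ (K * C)%R); first exact: ler_wpM2l.
    rewrite -ler_pdivrMl// eps2 mulrC.
    by rewrite lerDl.
  lra.
- move=> w /forallNP/(_ (2 * eps ^+ 2)%R)/existsNP[N /negP].
  rewrite -ltNge => Nw; exists N => // n /= Nn; rewrite /A /=.
  apply: (le_trans (ltW Nw)); rewrite (@big_cat_nat _ _ _ N 0 n)//=.
  by rewrite lerDl sumr_ge0// => i _; rewrite sqr_ge0.
Qed.

Definition l0_series (X : {linear H -> L0 P}) (a : nat -> H) (f : nat -> G)
    (w : T) : G :=
  lim (fourier_sum (fun j => (X (a j) : L0 P) w) f @ \oo).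

Lemma cvg_l0_series (X : {linear H -> L0 P}) (a : nat -> H) (f : nat -> G)
    (C : R) : orthonormal_seq f ->
  continuous X -> (forall n, (\sum_(0 <= i < n) `|a i| ^+ 2 <= C)%R) ->
  {ae P, forall w, fourier_sum (fun j => (X (a j) : L0 P) w) f @ \oo -->
    l0_series X a f w}.
Proof.
move=> onf cX aC; have := sum_sqr_bounded cX aC; apply: filterS => w [M wM].
exact: cvg_fourier_sum onf wM.
Qed.

Lemma L0_sumE I (r : seq I) (F : I -> L0 P) :
  {ae P, forall w, ((\sum_(i <- r) F i)%R : L0 P) w = (\sum_(i <- r) F i w)%R}.
Proof.
elim: r => [|i r IH].
  by apply: filterS (L0_0E P) => w; rewrite !big_nil.
apply: filter_app IH; have := L0_DE (F i) (\sum_(i <- r) F i)%R.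
by apply: filterS => w Fw IH; rewrite !big_cons Fw IH.
Qed.

(** The images of the partial sums of A g converge to X (A g) in probability,
    and almost surely they are the inner products with g of the partial sums of
    the series in G. *)
Lemma dotp_l0_series (X : {linear H -> L0 P}) (A : G -> H) (f : nat -> G)
    (C : R) (g : G) : orthonormal_seq f -> continuous X ->
  (forall n, (\sum_(0 <= i < n) `|A (f i)| ^+ 2 <= C)%R) ->
  fourier_sum (fun j => dotp g (f j)) (A \o f) @ \oo --> A g ->
  {ae P, forall w, dotp (l0_series X (A \o f) f w) g = (X (A g) : L0 P) w}.
Proof.
move=> onf cX AC cA.
pose b n : H := fourier_sum (fun j => dotp g (f j)) (A \o f) n.
have Xb : X (b n) @[n --> \oo] --> X (A g).
  by apply: (@cvg_comp _ _ _ b X _ (nbhs (A g))) => //; exact: cX.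
pose u n w := ((X (A g) : L0 P) w - (X (b n) : L0 P) w)%R.
have mu n : measurable_fun setT (u n).
  by apply: measurable_funB; exact: measurable_L0.
have u0 (e : R) : (0 < e)%R ->
    P [set w | (e <= `|u n w|)%R] @[n --> \oo] --> 0.
  by move=> e0; have /cvg_L0P := Xb; exact.
have bE n : {ae P, forall w, (X (b n) : L0 P) w =
    dotp (fourier_sum (fun j => (X (A (f j)) : L0 P) w) f n) g}.
  have h (j : nat) := L0_ZE (dotp g (f j)) (X (A (f j))).
  have := ae_foralln h; apply: filter_app.
  have -> : X (b n) = (\sum_(0 <= j < n) dotp g (f j) *: X (A (f j)))%R.
    by rewrite /b /fourier_sum linear_sum; apply: eq_bigr => j _; rewrite linearZ.
  have := L0_sumE (index_iota 0 n) (fun j => dotp g (f j) *: X (A (f j)))%R.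
  apply: filterS => w -> hw; rewrite dotp_suml; apply: eq_bigr => j _.
  by rewrite hw dotpZl mulrC (dotpC (f j)).
have uv : {ae P, forall w, u n w @[n --> \oo] -->
    ((X (A g) : L0 P) w - dotp (l0_series X (A \o f) f w) g)%R}.
  have := ae_foralln bE; apply: filter_app.
  have := cvg_l0_series onf cX AC; apply: filterS => w cw bw.
  apply: cvgB; first exact: cvg_cst.
  have : dotp (fourier_sum (fun j => (X (A (f j)) : L0 P) w) f n) g @[n --> \oo]
    --> dotp (l0_series X (A \o f) f w) g by apply: cvg_dotpl.
  by apply: cvg_trans; apply: near_eq_cvg; apply: nearW => n; rewrite bw.
have := ae_eq0_of_cvg_prob mu u0 uv; apply: filterS => w /eqP.
by rewrite subr_eq0 => /eqP.
Qed.

End fixed_time.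

(** * Borel sets and random elements of a separable Hilbert space *)

Section dynkin.
Context {d} {T : measurableType d} {R : realType} {P : probability T R}.
Local Open Scope ereal_scope.

(** Both sides are finite measures in B, so they agree on a sigma-algebra as
    soon as they have the same mass and agree on a generating pi-system. The
    factor x makes the statement cover independence as well as equality of
    laws. *)
Lemma prob_preimage_eq_sigma (E : Type) (C : set (set E)) (U V : T -> E)
    (A D : set T) (x : R) : (0 <= x)%R ->
  setI_closed C -> measurable A -> measurable D ->
  (forall B, <<s C >> B -> measurable (U @^-1` B)) ->
  (forall B, <<s C >> B -> measurable (V @^-1` B)) ->
  P A = x%:E * P D ->
  (forall B, C B -> P (U @^-1` B `&` A) = x%:E * P (V @^-1` B `&` D)) ->
  forall B, <<s C >> B -> P (U @^-1` B `&` A) = x%:E * P (V @^-1` B `&` D).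
Proof.
move=> x0 CI mA mD mU mV AD CE.
pose H := [set B | <<s C >> B /\
  P (U @^-1` B `&` A) = x%:E * P (V @^-1` B `&` D)].
suff CH : <<s C >> `<=` H by move=> B /CH[].
apply: lambda_system_subset => //; last first.
  by move=> B CB; split; [exact: sub_sigma_algebra|exact: CE].
have sC := smallest_sigma_algebra setT C.
have split_preim (W : T -> E) (F : set T) B : measurable F -> measurable (W @^-1` B) ->
    P F = P (W @^-1` B `&` F) + P (W @^-1` (~` B) `&` F).
  move=> mF mW; rewrite preimage_setC -(measureU _ (measurableI _ _ mW mF))//.
  - by rewrite -setIUl setUv setTI.
  - by apply: measurableI => //; exact: measurableC.
  - by rewrite setIACA setICr set0I.
apply/dynkin_lambda_system; split.
- split; last by rewrite !preimage_setT !setTI.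
  by by case: sC => s0 sD _; have := sD _ s0; rewrite setD0.
- move=> B [sB BE]; split.
    by case: sC => _ sD _; have := sD _ sB; rewrite setTD.
  have := AD; rewrite (split_preim U _ B mA (mU _ sB)) (split_preim V _ B mD (mV _ sB)).
  rewrite ge0_muleDr// -BE => /(congr1 (fun y => y - P (U @^-1` B `&` A))).
  have fin : P (U @^-1` B `&` A) \is a fin_num.
    by rewrite fin_num_measure//; apply: measurableI => //; exact: mU.
  by rewrite addeAC subee// add0e addeAC subee// add0e.
- move=> F tF HF; split.
    by case: sC => _ _; apply => n; have [] := HF n.
  rewrite !preimage_bigcup !setI_bigcupl.
  rewrite !measure_bigcup//.
  + rewrite -nneseriesZl//.
    by apply: eq_eseriesr => n _; case: (HF n).
  + by move=> n _; apply: measurableI => //; apply: mV; have [] := HF n.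
  + move=> i j _ _ [w [[Fi _] [Fj _]]]; apply: (tF i j I I).
    by eexists; split; [exact: Fi|exact: Fj].
  + by move=> n _; apply: measurableI => //; apply: mU; have [] := HF n.
  + move=> i j _ _ [w [[Fi _] [Fj _]]]; apply: (tF i j I I).
    by eexists; split; [exact: Fi|exact: Fj].
Qed.

End dynkin.

Section borel.
Context {R : realType} {G : hilbertType R}.

(** The countable dense set may be finite; indices that enumerate none of its
    points are sent to 0. *)
Lemma separable_seq : separable G -> exists c : nat -> G,
  forall x (e : R), 0 < e -> exists n, `|x - c n| < e.
Proof.
move=> [D /countable_injP[g ginj] dD].
pose c n := xget 0 [set x | D x /\ g x = n].
exists c => x e e0; have [] := dD (ball x e).
- by exists x; exact: ballxx.
- exact: ball_open.
- move=> y []; rewrite -ball_normE/= => xy Dy; exists (g y); rewrite /c.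
  case: xgetP => [z _ [Dz gzy]|/(_ y)]; last by move=> /not_andP[].
  by rewrite (_ : z = y)//; apply: ginj; rewrite ?inE.
Qed.

Context (f : nat -> G).
Hypotheses (sG : separable G) (onf : orthonormal_seq f) (tf : total_seq f).

Lemma norm_le_fourierP (x : G) (r : R) : 0 <= r ->
  `|x| <= r <-> forall n, \sum_(0 <= i < n) dotp x (f i) ^+ 2 <= r ^+ 2.
Proof.
move=> r0; split=> [xr n|xr].
  by apply: le_trans (bessel x n onf) _; rewrite lerXn2r ?nnegrE.
rewrite -(@ler_pXn2r _ 2) ?nnegrE//; have cx := parseval (x := x) onf tf.
rewrite -(cvg_lim (@Rhausdorff R) cx); apply: limr_le; last exact: nearW.
by apply/cvg_ex; exists (`|x| ^+ 2).
Qed.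

Section random_elements.
Context {d} {T : measurableType d}.
Implicit Types U V : T -> G.

(** Every open set is a countable union of closed balls, and belonging to a
    closed ball is a countable family of conditions on the coordinates. *)
Lemma random_elementP U :
  (forall i, measurable_fun setT (fun w => dotp (U w) (f i))) ->
  random_element U.
Proof.
move=> mU; apply: (@measurability _ _ _ (g_sigma_algebraType (@open G)) setT U
  (@open G) erefl) => _ [O oO <-].
rewrite setTI; have [c cP] := separable_seq sG.
pose F n k : set T := if `[< [set x | `|x - c n| <= k.+1%:R^-1] `<=` O >]
  then [set w | `|U w - c n| <= k.+1%:R^-1] else set0.
have -> : U @^-1` O = \bigcup_n \bigcup_k F n k.
  apply/seteqP; split=> [w /= Ow|w [n _ [k _]]].
    have /nbhs_ballP[r /= r0 rO] : nbhs (U w) O by exact: open_nbhs_nbhs.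
    have r20 : 0 < r / 2 by rewrite divr_gt0.
    have [k _ /(_ k (leqnn k)) kr] := near_infty_natSinv_lt (PosNum r20).
    have [n nk] := cP (U w) (k.+1%:R^-1) ltac:(by rewrite invr_gt0).
    exists n => //; exists k => //; rewrite /F; case: asboolP => [_|[]] /=.
      exact: ltW.
    move=> x /= xk; apply: rO; rewrite -ball_normE/=.
    rewrite -(subrKA (c n)) (le_lt_trans (ler_normD _ _))// [ltRHS]splitr.
    rewrite ltrD//; first exact: lt_trans nk kr.
    by rewrite distrC (le_lt_trans xk).
  by rewrite /F; case: asboolP => // kO /kO.
apply: bigcupT_measurable => n; apply: bigcupT_measurable => k.
rewrite /F; case: asboolP => _; last exact: measurable0.
rewrite (_ : [set w | _] = \bigcap_m [set w | \sum_(0 <= i < m)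
    (dotp (U w) (f i) - dotp (c n) (f i)) ^+ 2 <= k.+1%:R^-1 ^+ 2]); last first.
  have r0 : 0 <= k.+1%:R^-1 :> R by rewrite invr_ge0.
  apply/seteqP; split=> [w wk m _ /=|w wm].
    under eq_bigr do rewrite -dotpBl.
    exact: (norm_le_fourierP (U w - c n) r0).1 wk m.
  apply: (norm_le_fourierP (U w - c n) r0).2 => m.
  by have := wm m I; rewrite /=; under eq_bigr do rewrite -dotpBl.
apply: bigcapT_measurable => m; rewrite -[X in measurable X]setTI.
apply: measurable_fun_le => //; apply: measurable_sum => i.
by apply: measurable_funX; apply: measurable_funB.
Qed.

Lemma measurable_continuous_comp U (phi : G -> R) :
  random_element U -> continuous phi -> measurable_fun setT (phi \o U).
Proof.
move=> mU /continuousP cphi; apply: (measurability _ (RGenOpens.measurableE R)).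
move=> _ [_ [a [b ->] <-]]; rewrite comp_preimage.
by apply: mU => //; apply: sub_sigma_algebra; exact/cphi/interval_open.
Qed.

Lemma measurable_dotp U g : random_element U ->
  measurable_fun setT (fun w => dotp (U w) g).
Proof.
move=> mU; apply: (measurable_continuous_comp mU (phi := fun x => dotp x g)).
by move=> x; exact: cvg_dotpl.
Qed.

Lemma measurable_normG U : random_element U ->
  measurable_fun setT (fun w => `|U w|).
Proof.
move=> mU; apply: (measurable_continuous_comp mU).
exact: norm_continuous.
Qed.

Lemma random_elementB U V : random_element U -> random_element V ->
  random_element (fun w => U w - V w).
Proof.
move=> mU mV; apply: random_elementP => i; under eq_fun do rewrite dotpBl.
by apply: measurable_funB; exact: measurable_dotp.
Qed.

Lemma random_element_sum (I : Type) (r : seq I) (U : I -> T -> G) :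
  (forall i, random_element (U i)) ->
  random_element (fun w => \sum_(i <- r) U i w).
Proof.
move=> mU; apply: random_elementP => i; under eq_fun do rewrite dotp_suml.
by apply: measurable_sum => j; exact: measurable_dotp.
Qed.

End random_elements.

(** The conditions are a full sequence, trivial from some index on, so that
    cylinders with different numbers of coordinates intersect termwise. *)
Definition cylinder : set (set G) := [set A | exists n (O : nat -> set R),
  [/\ forall i, open (O i), forall i, (n <= i)%N -> O i = setT &
      A = [set x | forall i, O i (dotp x (f i))]]].

Lemma setI_closed_cylinder : setI_closed cylinder.
Proof.
move=> _ _ [n [O [oO OT ->]]] [m [O' [oO' OT' ->]]].
exists (maxn n m), (fun i => O i `&` O' i); split.
- by move=> i; exact: openI.
- by move=> i; rewrite geq_max => /andP[ni mi]; rewrite OT// OT'// setIT.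
- apply/seteqP; split=> [x [] h h' i|x h]; first by split; [exact: h|exact: h'].
  by split=> i; case: (h i).
Qed.

Lemma borel_cylinder : @borel_set R G `<=` <<s cylinder >>.
Proof.
have mcyl i : measurable_fun setT
    (fun x : g_sigma_algebraType cylinder => dotp (x : G) (f i)).
  apply: (measurability _ (RGenOpens.measurableE R)).
  move=> _ [_ [a [b ->] <-]]; rewrite setTI; apply: sub_sigma_algebra.
  exists i.+1, (fun j => if j == i then `]a, b[%classic else setT); split.
  - by move=> j; case: ifP => _; [exact: interval_open|exact: openT].
  - by move=> j ij; rewrite gtn_eqF.
  - apply/seteqP; split=> [x xab j|x /(_ i)]; last by rewrite eqxx.
    by case: eqP => [->|].
move=> B bB.
have := random_elementP (U := fun x : g_sigma_algebraType cylinder => (x : G)) mcyl.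
move=> /(_ measurableT B bB); rewrite setTI; exact.
Qed.

Lemma cylinder_borel : cylinder `<=` @borel_set R G.
Proof.
move=> _ [n [O [oO OT ->]]].
rewrite (_ : [set x | _] = \bigcap_i [set x | O i (dotp x (f i))]); last first.
  by apply/seteqP; split=> [x h i _|x h i]; [exact: h|exact: (h i I)].
apply: (@bigcapT_measurable _ (g_sigma_algebraType (@open G))) => i.
apply: sub_sigma_algebra.
apply: (@open_comp _ _ (fun x => dotp x (f i)) (O i)) => // x _.
exact: cvg_dotpl.
Qed.

End borel.

(** * Versions of a cylindrical Levy process are Levy processes *)

Section independence.
Context {d} {T : measurableType d} {R : realType} {P : probability T R}.
Context {E : normedModType R}.
Local Open Scope ereal_scope.

Lemma borel_preimage (U : T -> E) B : random_element U -> borel_set B ->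
  measurable (U @^-1` B).
Proof. by move=> mU bB; rewrite -[X in measurable X]setTI; exact: mU. Qed.

(** The sets of the pi-system are replaced by Borel sets one index at a
    time. *)
Lemma mutually_independent_sigma (C : set (set E)) n (U : 'I_n -> T -> E) :
  setI_closed C -> C setT -> C `<=` @borel_set R E -> @borel_set R E `<=` <<s C >> ->
  (forall i, random_element (U i)) ->
  (forall (J : {set 'I_n}) (B : 'I_n -> set E), (forall i, C (B i)) ->
    P (\bigcap_(i in [set` J]) (U i @^-1` B i)) =
    \prod_(i in J) P (U i @^-1` B i)) ->
  mutually_independent P U.
Proof.
move=> CI CT CB BC mU CP.
have sCB : <<s C >> `<=` @borel_set R E.
  by apply: smallest_sub => //; exact: smallest_sigma_algebra.
have msig i (B : set E) : <<s C >> B -> measurable (U i @^-1` B).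
  by move=> sB; apply: borel_preimage => //; exact: sCB.
suff H k : forall (J : {set 'I_n}) (B : 'I_n -> set E), (forall i, borel_set (B i)) ->
    (forall i : 'I_n, (k <= i)%N -> C (B i)) ->
    P (\bigcap_(i in [set` J]) (U i @^-1` B i)) =
    \prod_(i in J) P (U i @^-1` B i).
  by move=> J B bB; apply: (H n) => // i; rewrite leqNgt ltn_ord.
elim: k => [|k IH] J B bB kB; first by apply: CP => i; exact: kB.
have [kn|nk] := ltnP k n; last first.
  by apply: IH => // i ki; have := ltn_ord i; rewrite ltnNge (leq_trans nk).
pose K := Ordinal kn.
pose B' (A : set E) i := if i == K then A else B i.
have bB' A : borel_set A -> forall i, borel_set (B' A i).
  by move=> bA i; rewrite /B'; case: ifP.
have CB' A : C A -> forall i : 'I_n, (k <= i)%N -> C (B' A i).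
  move=> CA i ki; rewrite /B'; case: eqVneq => // iK; apply: kB.
  by rewrite ltn_neqAle ki andbT; apply: contra_neq iK => ?; exact: val_inj.
have prod_off A (J' : {set 'I_n}) : K \notin J' ->
    \prod_(i in J') P (U i @^-1` B' A i) = \prod_(i in J') P (U i @^-1` B i).
  move=> KJ; apply: eq_bigr => i iJ; rewrite /B'; case: eqP => // iK.
  by rewrite iK (negbTE KJ) in iJ.
have cap_off A (J' : {set 'I_n}) : K \notin J' ->
    \bigcap_(i in [set` J']) (U i @^-1` B' A i) =
    \bigcap_(i in [set` J']) (U i @^-1` B i).
  move=> KJ; apply: eq_bigcapr => i /= iJ; rewrite /B'; case: eqP => // iK.
  by rewrite iK (negbTE KJ) in iJ.
have [KJ|KJ] := boolP (K \in J); last first.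
  rewrite -(cap_off setT)// -(prod_off setT)//; apply: IH.
    by apply: bB'; exact: CB.
  exact: CB'.
pose J' := J :\ K.
have KJ' : K \notin J' by rewrite setD11.
have capJ A : \bigcap_(i in [set` J]) (U i @^-1` B' A i) =
    U K @^-1` A `&` \bigcap_(i in [set` J']) (U i @^-1` B i).
  rewrite -(cap_off A)//; apply/seteqP; split=> w.
    move=> h; split; first by have := h K KJ; rewrite /B' eqxx.
    by move=> i /=; rewrite in_setD1 => /andP[_ iJ]; exact: h.
  move=> [hK h] i /= iJ; have [->|iK] := eqVneq i K; first by rewrite /B' eqxx.
  by apply: h; rewrite /= in_setD1 iK.
have prodJ A : \prod_(i in J) P (U i @^-1` B' A i) =
    P (U K @^-1` A) * \prod_(i in J') P (U i @^-1` B i).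
  rewrite (big_setD1 K)//= {1}/B' eqxx; congr (_ * _).
  by rewrite prod_off.
have BE : B = B' (B K) by apply/funext => i; rewrite /B'; case: eqP => // ->.
have mA : measurable (\bigcap_(i in [set` J']) (U i @^-1` B i)).
  apply: fin_bigcap_measurable; first exact: finite_finset.
  move=> i _.
  by apply: borel_preimage; [exact: mU|exact: bB].
have PA : P (\bigcap_(i in [set` J']) (U i @^-1` B i)) =
    \prod_(i in J') P (U i @^-1` B i).
  rewrite -(cap_off setT)// -(prod_off setT)//; apply: IH.
    by apply: bB'; exact: CB.
  exact: CB'.
have fA := fin_num_measure P _ mA.
rewrite BE capJ prodJ -PA -(fineK fA) muleC -[X in _ = _ * P X]setIT.
apply: (prob_preimage_eq_sigma _ CI mA measurableT (msig K) (msig K)).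
- exact: fine_ge0.
- by rewrite fineK// probability_setT mule1.
- move=> A CA; rewrite setIT -capJ IH; last 2 first.
    by apply: bB'; exact: CB.
    exact: CB'.
  by rewrite prodJ -PA fineK// muleC.
- by apply: BC; exact: bB.
Qed.

Lemma borel_norm_ge (e : R) : borel_set [set x : E | (e <= `|x|)%R].
Proof.
rewrite -[X in borel_set X]setCK.
apply: (@measurableC _ (g_sigma_algebraType (@open E))); apply: sub_sigma_algebra.
rewrite (_ : ~` _ = (fun x : E => `|x|%R) @^-1` [set r | (r < e)%R]); last first.
  by apply/seteqP; split=> x /=; rewrite ltNge => /negP.
by apply: open_comp; [move=> x _; exact: norm_continuous|exact: open_lt].
Qed.

End independence.

Section versions.
Context {d} {T : measurableType d} {R : realType} {P : probability T R}.
Context {H G : hilbertType R} (X : R -> {linear H -> L0 P}) (A : G -> H).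
Context (f : nat -> G) (C : R).
Hypotheses (sG : separable G) (onf : orthonormal_seq f) (tf : total_seq f).
Hypothesis AC : forall n, \sum_(0 <= i < n) `|A (f i)| ^+ 2 <= C.
Hypothesis X_levy : cylindrical_levy X.
Hypothesis X_continuous : forall t, 0 <= t -> continuous (X t).

Let mX t h : measurable_fun setT (X t h : L0 P).
Proof. exact: measurable_L0. Qed.

Lemma norm_row1 (v : 'rV[R]_1) : `|v| = `|v 0 0|.
Proof.
have [->|v0] := eqVneq v 0; first by rewrite mxE !normr0.
have [|[i j] vij] := @mx_norm_neq0 _ _ _ v.
  by have : `|v| != 0 by rewrite normr_eq0.
by have -> : `|v| = `|v i j| by []; rewrite !ord1.
Qed.

Let X0 h : {ae P, forall w, (X 0 h : L0 P) w = 0}.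
Proof.
have [_ [+ _ _ _]] := X_levy (fun _ : 'I_1 => h).
by apply: filterS => w /matrixP/(_ 0 0); rewrite !mxE.
Qed.

Lemma cylindrical_small0 h (e c : R) : 0 < e -> 0 < c ->
  exists2 delta : R, 0 < delta & forall t, 0 <= t <= delta ->
    (P [set w | (e <= `|(X t h : L0 P) w|)%R] <= c%:E)%E.
Proof.
move=> e0 c0; have [mrow [_ sX _ _]] := X_levy (fun _ : 'I_1 => h).
pose N t := [set w | (e <= `|(X t h : L0 P) w - (X 0 h : L0 P) w|)%R].
have mN t : measurable (N t).
  by apply: (measurable_abs_ge (u := fun w => (X t h : L0 P) w - (X 0 h : L0 P) w));
    exact: measurable_funB.
have NX : P (N t) @[t --> within [set t | 0 <= t] (nbhs (0 : R))] --> 0%E.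
  have := sX 0 (lexx 0) e e0; apply: cvg_trans; apply: near_eq_cvg.
  apply: nearW => t; congr (P _); apply/seteqP; split=> w;
    by rewrite /N /= norm_row1 !mxE.
have /fine_cvgP[fX /cvgrPdist_lt/(_ _ c0) cX] := NX.
have /nbhs_ballP[delta /= delta0 deltaX] : \forall t \near nbhs (0 : R), 0 <= t ->
    (P (N t) <= c%:E)%E.
  near=> t => t0.
  have : `|0 - fine (P (N t))| < c by move: t0; near: t; exact: cX.
  have fN : P (N t) \is a fin_num by move: t0; near: t; exact: fX.
  rewrite sub0r normrN => /ltW /(le_trans (ler_norm _)).
  by rewrite -lee_fin fineK.
exists (delta / 2); first by rewrite divr_gt0.
move=> t /andP[t0 td].
have : (P (N t) <= c%:E)%E.
  apply: deltaX => //; rewrite -ball_normE/= sub0r normrN ger0_norm//.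
  by rewrite (le_lt_trans td)// ltr_pdivrMr// ltr_pMr// ltr1n.
apply: le_trans; rewrite le_eqVlt; apply/orP; left; apply/eqP.
apply: ae_eq_measurable_set => //; first exact: measurable_abs_ge.
by have := X0 h; apply: filterS => w; rewrite /N /= => ->; rewrite subr0.
Unshelve. all: by end_near. Qed.

Let cylindrical_small0_sum N (e c : R) : 0 < e -> 0 < c ->
  exists2 delta : R, 0 < delta & forall t, 0 <= t <= delta ->
    (P [set w | (e <= `|\sum_(0 <= i < N) (X t (A (f i)) : L0 P) w ^+ 2|)%R]
      <= c%:E)%E.
Proof.
elim: N e c => [|N IH] e c e0 c0.
  exists 1 => // t _; rewrite (_ : [set _ | _] = set0) ?measure0 ?lee_fin ?ltW//.
  apply/seteqP; split=> // w; rewrite /= big_geq// normr0 leNgt e0.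
  by [].
have e20 : 0 < e / 2 by rewrite divr_gt0.
have c20 : 0 < c / 2 by rewrite divr_gt0.
have [d1 d10 d1P] := IH _ _ e20 c20.
have s0 : 0 < Num.sqrt (e / 2) by rewrite sqrtr_gt0.
have [d2 d20 d2P] := cylindrical_small0 (A (f N)) s0 c20.
exists (Num.min d1 d2); first by rewrite lt_min d10.
move=> t /andP[t0]; rewrite le_min => /andP[td1 td2].
have mS k : measurable_fun setT
    (fun w => \sum_(0 <= i < k) (X t (A (f i)) : L0 P) w ^+ 2).
  by apply: measurable_sum => i; apply: measurable_funX.
have := prob_abs_le_add (e / 2) (e / 2) (mS N.+1) (mS N) (P := P).
rewrite -splitr => /le_trans; apply.
rewrite [c]splitr EFinD leeD//; first by apply: d1P; rewrite t0.
apply: le_trans (d2P t _); last by rewrite t0.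
apply: le_measure; rewrite ?inE.
- apply: (measurable_abs_ge (u := fun w => \sum_(0 <= i < N.+1) _ - _)).
  exact: measurable_funB.
- exact: measurable_abs_ge.
move=> w /=; rewrite big_nat_recr//= addrAC subrr add0r ger0_norm ?sqr_ge0//.
by rewrite -sqrtr_sqr; exact: ler_wsqrtr.
Qed.

Section version.
Variable Y : R -> T -> G.
Hypothesis mY : forall t, 0 <= t -> random_element (Y t).
Hypothesis YX : forall t, 0 <= t -> forall g,
  {ae P, forall w, dotp (Y t w) g = (X t (A g) : L0 P) w}.

Let Y_coord t : 0 <= t -> {ae P, forall w, forall i,
  dotp (Y t w) (f i) = (X t (A (f i)) : L0 P) w}.
Proof. by move=> t0; apply: ae_foralln => i; exact: YX. Qed.

Let Y0 : {ae P, forall w, Y 0 w = 0}.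
Proof.
have := ae_foralln (fun i => X0 (A (f i))); apply: filter_app.
have := Y_coord (lexx 0); apply: filterS => w Yw Xw.
by apply: tf => i; rewrite Yw Xw.
Qed.

(** The first N coordinates are small by stochastic continuity; the tail is
    small for all small t at once by equicontinuity and the sign-averaging
    bound, since it only involves the tail of the sum of the |A f_i|^2. *)
Lemma version_small0 (e c : R) : 0 < e -> 0 < c ->
  exists2 delta : R, 0 < delta & forall t, 0 <= t <= delta ->
    (P [set w | (e <= `|Y t w|)%R] <= c%:E)%E.
Proof.
move=> e0 c0.
(* The first N squares get e^2 / 2 and probability c / 2, the tail 2 (e / 4)^2
   and probability 10 (c / 40 + c / 40) = c / 2. *)
have c40 : 0 < c / 40 by rewrite divr_gt0.
have eps0 : 0 < e / 4 by rewrite divr_gt0.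
have bX h c' : 0 < c' -> exists2 n : nat, (0 < n)%N &
    forall t, 0 <= t <= n%:R^-1 ->
      (P [set w | (n%:R <= `|(X t h : L0 P) w|)%R] <= c'%:E)%E.
  move=> c'0; have [d1 d10 d1P] := cylindrical_small0 h ltr01 c'0.
  have [n _ /(_ n (leqnn n)) nd] := near_infty_natSinv_lt (PosNum d10).
  exists n.+1 => // t /andP[t0 tn].
  have td : 0 <= t <= d1 by rewrite t0 (le_trans tn)// ltW.
  apply: le_trans (d1P t td); apply: le_measure; rewrite ?inE; try exact: measurable_abs_ge.
  by move=> w /=; apply: le_trans; rewrite ler1n.
have [d1 d10 [K K0 KP]] := equicontinuous_at0 X_continuous bX c40 eps0.
have K10 : 0 < K + 1 by rewrite ltr_wpDl.
have [N NA] : exists N, forall n, (N <= n)%N ->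
    \sum_(N <= i < n) `|A (f i)| ^+ 2 <= c / 40 / (K + 1).
  have cv : cvgn (series (fun i => `|A (f i)| ^+ 2)).
    apply: nondecreasing_is_cvgn.
      by apply/nondecreasing_seqP => n; rewrite seriesSr lerDl sqr_ge0.
    by exists C => _ [n _ <-]; exact: AC.
  have /cauchy_seriesP cc : cauchy (series (fun i => `|A (f i)| ^+ 2) @ \oo).
    exact: cvg_cauchy.
  have [[B1 B2] /= [[n1 _ B1n] [n2 _ B2n]] B12] := cc _ (divr_gt0 c40 K10).
  exists (maxn n1 n2) => n mn.
  have := B12 (maxn n1 n2, n); rewrite /=.
  move=> /(_ _)/ltW/(le_trans (ler_norm _)); apply; split=> /=.
    by apply: B1n; rewrite /= leq_maxl.
  by apply: B2n => /=; rewrite (leq_trans _ mn)// leq_maxr.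
have e220 : 0 < e ^+ 2 / 2 by rewrite divr_gt0// exprn_gt0.
have c20 : 0 < c / 2 by rewrite divr_gt0.
have [d2 d20 d2P] := cylindrical_small0_sum N e220 c20.
exists (Num.min d1 d2); first by rewrite lt_min d10.
move=> t /andP[t0]; rewrite le_min => /andP[td1 td2].
have cX := KP t; rewrite t0 td1 in cX.
pose B n := [set w | (2 * (e / 4) ^+ 2 <=
  \sum_(N <= i < n) (X t (A (f i)) : L0 P) w ^+ 2)%R].
have mB n : measurable (B n).
  rewrite -[X in measurable X]setTI; apply: measurable_fun_le => //.
  by apply: measurable_sum => i; apply: measurable_funX.
have PB : (P (eventually_in B) <= (c / 2)%:E)%E.
  apply: prob_eventually_in_le => //; near=> n.
  have := prob_sum_sqr_le (map (A \o f) (index_iota N n)) eps0 (cX isT).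
  rewrite /B; under eq_set do rewrite big_map; rewrite big_map => /le_trans; apply.
  rewrite lee_fin.
  have : K * (\sum_(N <= i < n) `|A (f i)| ^+ 2) <= c / 40.
    apply: (@le_trans _ _ ((K + 1) * (\sum_(N <= i < n) `|A (f i)| ^+ 2))).
      by rewrite ler_wpM2r ?lerDl// sumr_ge0// => i _; rewrite sqr_ge0.
    by rewrite mulrC -ler_pdivlMr//; apply: NA; near: n; exists N.
  rewrite /=; lra.
pose D := [set w | (e ^+ 2 / 2 <=
  `|\sum_(0 <= i < N) (X t (A (f i)) : L0 P) w ^+ 2|)%R].
have mD : measurable D.
  by apply: measurable_abs_ge; apply: measurable_sum => i; exact: measurable_funX.
have PD : (P D <= (c / 2)%:E)%E by apply: d2P; rewrite t0.
have mBe := measurable_eventually_in mB.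
rewrite [c]splitr EFinD; apply: le_trans (leeD PD PB).
apply: le_trans (measureU2 _ mD mBe).
pose E := [set w | forall i, dotp (Y t w) (f i) = (X t (A (f i)) : L0 P) w].
have mE : measurable [set w | (e <= `|Y t w|)%R].
  rewrite -[X in measurable X]setTI; apply: measurable_fun_le => //.
  by apply: measurable_normG; exact: mY.
have [Z [mZ PZ0 ZE]] := Y_coord t0.
apply: (@le_trans _ _ (P ((D `|` eventually_in B) `|` Z))).
  apply: le_measure; rewrite ?inE; [by []|by apply: measurableU => //; apply: measurableU|].
  move=> w /= eY; have [Zw|nZw] := pselect (Z w); [by right|left].
  have Ew : forall i, dotp (Y t w) (f i) = (X t (A (f i)) : L0 P) w.
    by apply: contrapT => nE; exact/nZw/ZE.
  have [Dw|nDw] := pselect (D w); [by left|right].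
  have e80 : 0 < e ^+ 2 / 8 by rewrite divr_gt0// exprn_gt0.
  have /cvgrPdist_lt/(_ _ e80)[n0 _ n0P] := parseval (x := Y t w) onf tf.
  exists (maxn N n0) => // n /=; rewrite geq_max => /andP[Nn n0n].
  have := n0P n n0n; under eq_bigr do rewrite Ew.
  rewrite (@big_cat_nat _ _ _ N 0 n)//= /B/=.
  move: nDw; rewrite /D /= => /negP; rewrite -ltNge.
  have : e ^+ 2 <= `|Y t w| ^+ 2 by rewrite lerXn2r ?nnegrE// ltW.
  set S1 := \sum_(0 <= i < N) _; set S2 := \sum_(N <= i < n) _.
  move=> eY2 /(le_lt_trans (ler_norm _)) S1e /(le_lt_trans (ler_norm _)) YS.
  lra.
apply: le_trans (measureU2 _ (measurableU _ _ mD mBe) mZ) _.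
by rewrite [X in (_ + X)%E](PZ0 : P Z = 0%E) adde0.
Unshelve. all: by end_near. Qed.

Let row n t w : 'rV[R]_n := \row_(i < n) (X t (A (f i)) : L0 P) w.

Let row_set n (O : nat -> set R) : set 'rV[R]_n := [set v : 'rV[R]_n | forall i : 'I_n, O i (v 0 i)].

Let borel_row_set n (O : nat -> set R) : (forall i, open (O i)) ->
  borel_set (@row_set n O).
Proof.
move=> oO; rewrite (_ : @row_set n O =
    \bigcap_(i in [set: 'I_n]) [set v : 'rV[R]_n | O i (v 0 i)]); last first.
  by apply/seteqP; split=> [v h i _|v h i]; [exact: h|exact: (h i I)].
apply: (@fin_bigcap_measurable _ (g_sigma_algebraType (@open 'rV[R]_n))).
  exact: finite_finset.
move=> i _; apply: sub_sigma_algebra.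
by apply: (@open_comp _ _ (fun v : 'rV[R]_n => v 0 i) (O i)) => // x _;
  exact: coord_continuous.
Qed.

Let measurable_row_set n (O : nat -> set R) s t : (forall i, open (O i)) ->
  measurable [set w | row_set O (row n t w - row n s w)].
Proof.
move=> oO; rewrite (_ : [set w | _] = \bigcap_(i in [set: 'I_n])
    ((fun w => (X t (A (f i)) : L0 P) w - (X s (A (f i)) : L0 P) w) @^-1` O i)); last first.
  apply/seteqP; split=> [w h i _|w h i]; first by have := h i; rewrite !mxE.
  by have := h i I; rewrite !mxE.
apply: fin_bigcap_measurable; first exact: finite_finset.
move=> i _; rewrite -[X in measurable X]setTI.
apply: measurable_funB => //; exact: open_measurable.
Qed.

(** On a cylinder, the increments of Y can be exchanged for increments of the
    Levy process formed by finitely many of the X_t(A f_i). *)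
Let ae_cylinder n (O : nat -> set R) s t : 0 <= s -> 0 <= t ->
  (forall i, (n <= i)%N -> O i = setT) ->
  {ae P, forall w, (forall i, O i (dotp (Y t w - Y s w) (f i))) <->
    row_set O (row n t w - row n s w)}.
Proof.
move=> s0 t0 OT; have := Y_coord s0; apply: filter_app.
have := Y_coord t0; apply: filterS => w tw sw.
split=> [h i|h i]; first by rewrite !mxE -tw -sw -dotpBl.
have [ni|i_n] := leqP n i; first by rewrite OT.
by have := h (Ordinal i_n); rewrite !mxE -tw -sw -dotpBl.
Qed.

Let mYB s t : 0 <= s -> 0 <= t -> random_element (fun w => Y t w - Y s w).
Proof.
by move=> s0 t0; apply: (random_elementB sG onf tf); exact: mY.
Qed.

Lemma version_stationary : stationary_increments P Y.
Proof.
move=> s h s0 h0 B bB.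
have sh0 : 0 <= s + h by rewrite addr_ge0.
have mcyl u v B' : 0 <= u -> 0 <= v -> <<s cylinder f >> B' ->
    measurable ((fun w => Y v w - Y u w) @^-1` B').
  move=> u0 v0 sB'; apply: borel_preimage; first exact: mYB.
  by move: B' sB'; apply: smallest_sub;
    [exact: smallest_sigma_algebra|exact: cylinder_borel].
have := @prob_preimage_eq_sigma _ _ _ P _ (cylinder f)
  (fun w => Y (s + h) w - Y s w) (fun w => Y h w - Y 0 w) setT setT 1 ler01
  (@setI_closed_cylinder _ _ f) measurableT measurableT.
move=> /(_ (fun B' => mcyl _ _ B' s0 sh0) (fun B' => mcyl _ _ B' (lexx 0) h0)).
rewrite mul1e => /(_ erefl) H'.
have := H' _ B (borel_cylinder sG onf tf bB); rewrite mul1e !setIT; apply.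
move=> {bB}B [n [O [oO OT ->]]]; rewrite mul1e !setIT.
transitivity (P [set w | row_set O (row n (s + h) w - row n s w)]).
  apply: ae_eq_measurable_set; [|exact: measurable_row_set|exact: ae_cylinder].
  apply: mcyl => //; apply: sub_sigma_algebra; by exists n, O.
transitivity (P [set w | row_set O (row n h w - row n 0 w)]).
  have [_ [_ _ sX _]] := X_levy (fun i : 'I_n => A (f i)).
  exact: (sX s h s0 h0 _ (borel_row_set oO)).
apply: ae_eq_measurable_set; [exact: measurable_row_set| |].
  apply: mcyl => //; apply: sub_sigma_algebra; by exists n, O.
by apply: filterS (ae_cylinder (lexx 0) h0 OT) => w [? ?]; split.
Qed.

Lemma version_independent : independent_increments P Y.
Proof.
move=> n t t0 ndt.
have tk k : 0 <= t k by apply: le_trans t0 _; exact: ndt.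
apply: (mutually_independent_sigma (C := cylinder f)).
- exact: setI_closed_cylinder.
- by exists 0, (fun=> setT); split=> // [i|]; [exact: openT|apply/seteqP; split].
- exact: cylinder_borel.
- exact: borel_cylinder.
- by move=> i; exact: mYB.
move=> J B CB.
have /choice[m mP] : forall i : 'I_n, exists m, exists O : nat -> set R,
    [/\ forall j, open (O j), forall j, (m <= j)%N -> O j = setT &
      B i = [set x | forall j, O j (dotp x (f j))]] by exact: CB.
have [O OP] := choice mP.
pose N := \max_(i < n) m i.
have mN i : (m i <= N)%N by exact: leq_bigmax.
have oO i := let: And3 h _ _ := OP i in h.
have OT i j : (N <= j)%N -> O i j = setT.
  by move=> Nj; have [_ + _] := OP i; apply; exact: leq_trans Nj.
pose U (i : 'I_n) w := Y (t i.+1) w - Y (t i) w.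
pose V (i : 'I_n) w := row N (t i.+1) w - row N (t i) w.
have mU i : measurable (U i @^-1` B i).
  by apply: borel_preimage; [exact: mYB|exact: (cylinder_borel (CB i))].
have mV i : measurable (V i @^-1` row_set (O i)) by exact: measurable_row_set.
have UV : {ae P, forall w, forall i, B i (U i w) <-> row_set (O i) (V i w)}.
  apply: filter_forall => i.
  have := ae_cylinder (tk i) (tk i.+1) (OT i); apply: filterS => w h.
  by have [_ _ ->] := OP i.
have [_ [_ _ _ iX]] := X_levy (fun i : 'I_N => A (f i)).
have := iX n t t0 ndt J (fun i => row_set (O i)) (fun i => borel_row_set (oO i)).
rewrite -/(V _) => VE.
transitivity (P (\bigcap_(i in [set` J]) (V i @^-1` row_set (O i)))).
  apply: ae_eq_measurable_set.
  - by apply: fin_bigcap_measurable => [|i _]; [exact: finite_finset|exact: mU].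
  - by apply: fin_bigcap_measurable => [|i _]; [exact: finite_finset|exact: mV].
  - apply: filterS UV => w h; split=> hw i iJ; exact/h/hw.
rewrite VE; apply: eq_bigr => i _.
apply: ae_eq_measurable_set; [exact: mV|exact: mU|].
by apply: filterS UV => w h; split => /h.
Qed.

Lemma version_increment_small (e c : R) : 0 < e -> 0 < c ->
  exists2 delta : R, 0 < delta & forall s t, 0 <= s -> 0 <= t ->
    `|t - s| <= delta ->
    (P [set w | (e <= `|Y t w - Y s w|)%R] <= c%:E)%E.
Proof.
move=> e0 c0; have [delta delta0 deltaP] := version_small0 e0 c0.
exists delta => // s t s0 t0.
wlog st : s t s0 t0 / s <= t => [hw|].
  have [st|/ltW ts] := leP s t; first exact: hw.
  by rewrite distrC; under eq_set do rewrite distrC; exact: hw.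
rewrite ger0_norm ?subr_ge0// => std.
have ts0 : 0 <= t - s by rewrite subr_ge0.
pose B : set G := [set x | e <= `|x|].
have bB : borel_set B by exact: borel_norm_ge.
have := version_stationary s0 ts0 bB; rewrite subrKC => ->.
apply: le_trans (deltaP (t - s) _); last by rewrite ts0.
rewrite le_eqVlt; apply/orP; left; apply/eqP; apply: ae_eq_measurable_set.
- by apply: borel_preimage => //; exact: mYB.
- rewrite -[X in measurable X]setTI; apply: measurable_fun_le => //.
  by apply: measurable_normG; exact: mY.
- by apply: filterS Y0 => w Y0w; rewrite /B /= Y0w subr0.
Qed.

Lemma version_stochastically_continuous : stochastically_continuous P Y.
Proof.
move=> t t0 e e0.
have mE s : 0 <= s -> measurable [set w | e <= `|Y s w - Y t w|].
  move=> s0; rewrite -[X in measurable X]setTI; apply: measurable_fun_le => //.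
  by apply: measurable_normG; exact: mYB.
have pos : \forall s \near within [set s | 0 <= s] (nbhs t), 0 <= s.
  exact: withinT.
apply/fine_cvgP; split.
  by apply: filterS pos => s s0; rewrite fin_num_measure//; exact: mE.
apply/cvgr0Pnorm_le => c c0.
have [delta delta0 deltaP] := version_increment_small e0 c0.
near=> s.
have s0 : 0 <= s by near: s.
rewrite ger0_norm ?fine_ge0// -lee_fin fineK; last first.
  by rewrite fin_num_measure//; exact: mE.
apply: deltaP => //; near: s; apply: cvg_within.
have /nbhs_ballP : nbhs t (ball t delta) by exact: nbhsx_ballx.
move=> [r /= r0 rd]; apply/nbhs_ballP; exists r => //= s /rd.
by rewrite -ball_normE/= distrC => /ltW.
Unshelve. all: by end_near. Qed.

Lemma version_levy : levy_process P Y.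
Proof.
split=> //; split; [exact: Y0|exact: version_stochastically_continuous|
  exact: version_stationary|exact: version_independent].
Qed.

End version.

End versions.

(** * Counting oscillations *)

Section greedy_count.
Context {R : realType} {V : normedModType R}.
Implicit Types (z : nat -> V) (e : R).

(** Walking along z, an anchor is dropped at 0 and moved to the current index
    whenever the distance to the anchored value reaches 2e. The first
    component counts the moves, the second is the anchor. *)
Fixpoint greedy e z k : nat * nat :=
  if k is k'.+1 then
    let: (c, a) := greedy e z k' in
    if 2 * e <= `|z k - z a| then (c.+1, k) else (c, a)
  else (0, 0)%N.

Definition moves e z k := (greedy e z k).1.
Definition anchor e z k := (greedy e z k).2.

Lemma movesS e z k : moves e z k.+1 =
  if 2 * e <= `|z k.+1 - z (anchor e z k)| then (moves e z k).+1 else moves e z k.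
Proof. by rewrite /moves /anchor /=; case: (greedy e z k) => c a /=; case: ifP. Qed.

Lemma anchorS e z k : anchor e z k.+1 =
  if 2 * e <= `|z k.+1 - z (anchor e z k)| then k.+1 else anchor e z k.
Proof. by rewrite /anchor /=; case: (greedy e z k) => c a /=; case: ifP. Qed.

Lemma anchor_le e z k : (anchor e z k <= k)%N.
Proof. by elim: k => // k IH; rewrite anchorS; case: ifP => // _; exact: leqW. Qed.

Lemma moves_le e z i j : (i <= j)%N -> (moves e z i <= moves e z j)%N.
Proof.
apply: (@homo_leq _ _ leq leqnn) => [a b c|k]; first exact: leq_trans.
by rewrite movesS; case: ifP.
Qed.

Lemma greedy_anchor e z k : greedy e z (anchor e z k) = greedy e z k.
Proof.
elim: k => // k IH; rewrite anchorS; case: ifP => // dk.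
rewrite IH /=; move: dk; rewrite /anchor.
by case: (greedy e z k) => c a /= ->.
Qed.

Lemma moves_anchor e z k : moves e z (anchor e z k) = moves e z k.
Proof. by rewrite /moves greedy_anchor. Qed.

Lemma anchor_anchor e z k : anchor e z (anchor e z k) = anchor e z k.
Proof. by rewrite /anchor greedy_anchor. Qed.

Lemma anchored_succ e z k : anchor e z k.+1 = k.+1 ->
  2 * e <= `|z k.+1 - z (anchor e z k)| /\ moves e z k.+1 = (moves e z k).+1.
Proof.
rewrite anchorS movesS; case: ifP => // _ ak.
by have := anchor_le e z k; rewrite ak ltnn.
Qed.

(** Each number of moves has a unique anchored index, the one where the last
    move happened. *)
Lemma anchored_inj e z i j : anchor e z i = i -> anchor e z j = j ->
  moves e z i = moves e z j -> i = j.
Proof.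
wlog ij : i j / (i <= j)%N => [hw ai aj cij|ai aj cij].
  by have [ij|/ltnW ji] := leqP i j; [exact: hw|apply/esym/hw].
apply/eqP; rewrite eqn_leq ij/= leqNgt; apply/negP.
case: j ij aj cij => // j _ aj cij; rewrite ltnS => ij.
have [_] := anchored_succ aj; rewrite -cij => ci.
by have := moves_le e z ij; rewrite ci ltnn.
Qed.

Lemma moves_attained e z m p : (p <= moves e z m)%N ->
  exists i, [/\ (i <= m)%N, moves e z i = p & anchor e z i = i].
Proof.
elim: m => [|m IH]; first by rewrite leqn0 => /eqP ->; exists 0%N.
have [pm _|pm] := leqP p (moves e z m).
  by have [i [im ci ai]] := IH pm; exists i; split => //; exact: leqW.
rewrite movesS; case: ifP => dm; last by rewrite leqNgt pm.
move=> pm'; exists m.+1; split=> //; last by rewrite anchorS dm.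
by rewrite movesS dm; apply/eqP; rewrite eqn_leq pm.
Qed.

Lemma anchored_prev e z j p : anchor e z j = j -> moves e z j = p.+1 ->
  exists i, [/\ (i < j)%N, moves e z i = p, anchor e z i = i &
    2 * e <= `|z j - z i|].
Proof.
case: j => // j aj; have [dj ->] := anchored_succ aj => -[cj].
exists (anchor e z j); split=> //; first by rewrite ltnS anchor_le.
  by rewrite moves_anchor.
exact: anchor_anchor.
Qed.

Lemma dist_anchor e z k : 0 < e -> `|z k - z (anchor e z k)| < 2 * e.
Proof.
move=> e0; have e20 : 0 < 2 * e by rewrite mulr_gt0.
elim: k => [|k IH]; first by rewrite subrr normr0.
rewrite anchorS; case: ifPn => [_|]; first by rewrite subrr normr0.
by rewrite -ltNge.
Qed.

(** Values that share an anchor lie within 2e of it. *)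
Lemma moves_lt e z i j : 0 < e -> (i <= j)%N -> 4 * e <= `|z i - z j| ->
  (moves e z i < moves e z j)%N.
Proof.
move=> e0 ij; apply: contraTT; rewrite -leqNgt -ltNge => cji.
have cij : moves e z i = moves e z j.
  by apply/eqP; rewrite eqn_leq moves_le.
have aij : anchor e z i = anchor e z j.
  by apply: (@anchored_inj e z); rewrite ?anchor_anchor// !moves_anchor.
rewrite -(subrKA (z (anchor e z i))) (le_lt_trans (ler_normD _ _))//.
rewrite (_ : 4 * e = 2 * e + 2 * e); last by ring.
by rewrite ltrD ?dist_anchor// aij distrC dist_anchor.
Qed.

Lemma measurable_greedy d (T : measurableType d) e (z : nat -> T -> V) i :
  (forall a k, (a <= k <= i)%N -> measurable [set w | 2 * e <= `|z k w - z a w|]) ->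
  forall k (S : set (nat * nat)), (k <= i)%N ->
    measurable [set w | S (greedy e (z^~ w) k)].
Proof.
move=> mz; elim=> [|k IH] S ki.
  have [S0|nS0] := pselect (S (0, 0)%N).
    by rewrite (_ : [set w | _] = setT); [exact: measurableT|apply/seteqP; split].
  by rewrite (_ : [set w | _] = set0); [exact: measurable0|apply/seteqP; split].
rewrite (_ : [set w | _] = \bigcup_c \bigcup_(a in `I_k.+1)
  ([set w | greedy e (z^~ w) k = (c, a)] `&`
   (if `[< S (c.+1, k.+1) >] then [set w | 2 * e <= `|z k.+1 w - z a w|] else set0) `|`
   [set w | greedy e (z^~ w) k = (c, a)] `&`
   (if `[< S (c, a) >] then ~` [set w | 2 * e <= `|z k.+1 w - z a w|] else set0))).
  apply: bigcupT_measurable => c; apply: bigcup_measurable => a; rewrite /= ltnS => ak.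
  have md : measurable [set w | 2 * e <= `|z k.+1 w - z a w|].
    by apply: mz; rewrite ki andbT leqW.
  have mg : measurable [set w | greedy e (z^~ w) k = (c, a)].
    by apply: (IH [set ca | ca = (c, a)]); exact: ltnW.
  apply: measurableU; apply: measurableI => //; case: ifP => _ //.
  exact: measurableC.
apply/seteqP; split=> w.
  rewrite /=; case ga : (greedy e (z^~ w) k) => [c a] Sw.
  exists c => //; exists a.
    by rewrite /= ltnS; have := anchor_le e (z^~ w) k; rewrite /anchor ga.
  by case: ifPn Sw => da Sw; [left|right]; split => //=; case: asboolP => //= _; exact/negP.
move=> [c _ [a _ [|]]] [/= ->].
  by case: asboolP => //= ? ->.
by case: asboolP => //= ? /negP/negbTE ->.
Qed.

End greedy_count.

Section oscillation_probability.
Context {d} {T : measurableType d} {R : realType} {P : probability T R}.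
Context {G : hilbertType R} (f : nat -> G).
Hypotheses (sG : separable G) (onf : orthonormal_seq f) (tf : total_seq f).
Context (Z : R -> T -> G) (t : nat -> R) (m : nat) (e : R).
Hypothesis mZ : forall s, 0 <= s -> random_element (Z s).
Hypothesis iZ : independent_increments P Z.
Hypotheses (t0 : 0 <= t 0) (nt : nondecreasing_seq t).
Local Open Scope ereal_scope.

Let tk k : (0 <= t k)%R.
Proof. by apply: le_trans t0 _; exact: nt. Qed.

Let incr k w := (Z (t k.+1) w - Z (t k) w)%R.

Let mincr s s' : (0 <= s)%R -> (0 <= s')%R ->
  random_element (fun w => Z s w - Z s' w)%R.
Proof. by move=> ? ?; apply: (random_elementB sG onf tf); exact: mZ. Qed.

Let measurable_ge s s' r : (0 <= s)%R -> (0 <= s')%R ->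
  measurable [set w | (r <= `|Z s w - Z s' w|)%R].
Proof.
move=> s0 s'0; rewrite -[X in measurable X]setTI; apply: measurable_fun_le => //.
by apply: measurable_normG; exact: mincr.
Qed.

Let past i : set (set T) := [set A | exists2 B : nat -> set G,
  forall k, borel_set (B k) & A = \bigcap_(k in `I_i) (incr k @^-1` B k)].

Let setI_closed_past i : setI_closed (past i).
Proof.
move=> _ _ [B bB ->] [B' bB' ->]; exists (fun k => B k `&` B' k).
  by move=> k; apply: (@measurableI _ (g_sigma_algebraType (@open G))); [exact: bB|exact: bB'].
by rewrite -bigcapI.
Qed.

Let measurable_past i A : <<s past i >> A -> measurable A.
Proof.
apply: smallest_sub.
  split; [exact: measurable0|by move=> B mB; exact: measurableD|].
  by move=> F mF; exact: bigcupT_measurable.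
move=> _ [B bB ->]; apply: fin_bigcap_measurable => [|k _].
  exact: finite_II.
by apply: borel_preimage; [exact: mincr|exact: bB].
Qed.

Let measurable_past_incr i k : (k < i)%N ->
  random_element (incr k : g_sigma_algebraType (past i) -> G).
Proof.
move=> ki _ B bB; rewrite setTI; apply: sub_sigma_algebra.
exists (fun j => if j == k then B else setT).
  move=> j; case: ifP => // _.
  exact: (@measurableT _ (g_sigma_algebraType (@open G))).
apply/seteqP; split=> [w Bw j _|w /(_ k ki)]; last by rewrite /= eqxx.
by case: eqP => // ->.
Qed.

(** The position relative to an earlier index of the past is a sum of
    increments of the past. *)
Let measurable_past_dist i a k : (a <= k <= i)%N ->
  measurable ([set w | (2 * e <= `|Z (t k) w - Z (t a) w|)%R] :
    set (g_sigma_algebraType (past i))).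
Proof.
move=> /andP[ak ki].
pose D (j : nat) : g_sigma_algebraType (past i) -> G :=
  if (j < i)%N then incr j else (fun=> 0%R).
have mD j : random_element (D j).
  rewrite /D; case: ifPn => ji; first exact: measurable_past_incr.
  exact: measurable_cst.
have DE w : (Z (t k) w - Z (t a) w = \sum_(a <= j < k) D j w)%R.
  rewrite -(telescope_sumr (fun j => Z (t j) w) ak).
  by apply: eq_big_nat => j /andP[_ jk]; rewrite /D (leq_trans jk ki).
under eq_set do rewrite DE.
rewrite -[X in measurable X]setTI; apply: measurable_fun_le => //.
by apply: measurable_normG; apply: (random_element_sum sG onf tf).
Qed.

(** Applied to the times t_0, .., t_i, t_m, independence of increments holds on
    the pi-system that generates the past up to i. *)
Let past_independent i A : (i <= m)%N -> <<s past i >> A ->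
  P (A `&` [set w | (e <= `|Z (t m) w - Z (t i) w|)%R]) =
  P [set w | (e <= `|Z (t m) w - Z (t i) w|)%R] * P A.
Proof.
move=> im pA; set F := [set w | _].
have mF : measurable F by exact: measurable_ge.
have fF := fin_num_measure P _ mF.
rewrite -(fineK fF) -[X in _ = _ * P X]setIT.
apply: (@prob_preimage_eq_sigma _ _ _ P _ (past i) id id F setT (fine (P F)) (fine_ge0 _)
  (@setI_closed_past i) mF measurableT) => //.
- exact: measurable_past.
- exact: measurable_past.
- by rewrite fineK// probability_setT mule1.
move=> {A pA}_ [B bB ->]; rewrite /= setIT fineK//.
pose t' k := if (k <= i)%N then t k else t m.
have nt' : nondecreasing_seq t'.
  apply/nondecreasing_seqP => k; rewrite /t'; case: ifPn => ki.
    by case: ifP => _; apply: nt => //; exact: leq_trans im.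
  by rewrite ifN// -ltnNge; rewrite -ltnNge in ki; exact: leqW.
have t'0 : (0 <= t' 0%N)%R by rewrite /t' leq0n.
pose Bm : set G := [set x | (e <= `|x|)%R].
have bBm : borel_set Bm by exact: borel_norm_ge.
have bT : borel_set [set: G] by exact: (@measurableT _ (g_sigma_algebraType (@open G))).
have ind := @iZ i.+1 t' t'0 nt'.
pose B1 C (k : 'I_i.+1) := if (k < i)%N then B k else C.
have bB1 C : borel_set C -> forall k, borel_set (B1 C k).
  by move=> bC k; rewrite /B1; case: ifP.
have H C : borel_set C ->
    P ((\bigcap_(k in `I_i) (incr k @^-1` B k)) `&` (fun w => Z (t m) w - Z (t i) w)%R @^-1` C) =
    P ((fun w => Z (t m) w - Z (t i) w)%R @^-1` C) *
      \prod_(k < i) P (incr k @^-1` B k).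
  move=> bC; have := ind (@finset.finset 'I_i.+1 xpredT) (B1 C) (bB1 C bC).
  rewrite big_mkcond/= big_ord_recr/= inE muleC.
  have lastE : (fun w => Z (t' i.+1) w - Z (t' i) w)%R =
      (fun w => Z (t m) w - Z (t i) w)%R by rewrite /t' ltnn leqnn.
  have prevE (k : nat) : (k < i)%N -> (fun w => Z (t' k.+1) w - Z (t' k) w)%R = incr k.
    by move=> ki; rewrite /t' ki ltnW.
  have lastB : B1 C ord_max = C by rewrite /B1 /= ltnn.
  rewrite lastE lastB => H'.
  rewrite (eq_bigr (fun k : 'I_i => P (incr k @^-1` B k))) in H'; last first.
    by move=> k _; rewrite inE prevE// /B1/= ltn_ord.
  rewrite -H'; congr (P _); apply/seteqP; split=> w.
    move=> [hw hC] k _; have [ki|ik] := ltnP k i.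
      by rewrite prevE// /B1 ki; exact: hw.
    have ki : (k : nat) = i by apply/eqP; rewrite eqn_leq ik andbT -ltnS.
    by rewrite ki lastE /B1 ki ltnn.
  move=> hw.
  have hw' (k : 'I_i.+1) : ((fun w => Z (t' k.+1) w - Z (t' k) w)%R @^-1` B1 C k) w.
    by apply: hw; rewrite /= inE.
  split; last by have := hw' ord_max; rewrite lastE lastB.
  move=> k ki; have := hw' (Ordinal (leqW ki : (k < i.+1)%N)).
  by rewrite (prevE _ ki) /B1/= ki.
have := H _ bT; rewrite preimage_setT setIT probability_setT mul1e => ->.
exact: H bBm.
Qed.

Let ev p i := [set w | moves e (fun k => Z (t k) w) i = p /\
  anchor e (fun k => Z (t k) w) i = i].

Let past_ev p i : <<s past i >> (ev p i).
Proof.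
have := @measurable_greedy _ _ _ (g_sigma_algebraType (past i)) e (fun k => Z (t k)) i.
move=> /(_ (@measurable_past_dist i) i [set ca | ca.1 = p /\ ca.2 = i] (leqnn i)).
exact.
Qed.

Lemma measurable_moves_ge p i :
  measurable [set w | (p <= moves e (fun k => Z (t k) w) i)%N].
Proof.
apply: (@measurable_past i).
have := @measurable_greedy _ _ _ (g_sigma_algebraType (past i)) e (fun k => Z (t k)) i.
by move=> /(_ (@measurable_past_dist i) i [set ca | (p <= ca.1)%N] (leqnn i)).
Qed.

(** At each move, from an anchored index i to the next one j, the increment up
    to the final time is at least e from i or from j. These increments are
    independent of the past up to i or j, so the probabilities x_p of at least p
    moves satisfy x_(p+1) <= (x_p + x_(p+1)) / 3. *)
Lemma prob_moves_le p :
  (forall i, (i <= m)%N -> P [set w | (e <= `|Z (t m) w - Z (t i) w|)%R] <= (3^-1)%:E) ->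
  P [set w | (p <= moves e (fun k => Z (t k) w) m)%N] <= (2^-1 ^+ p)%:E.
Proof.
move=> PF.
pose Ev p := [set w | (p <= moves e (fun k => Z (t k) w) m)%N].
pose F i := [set w | (e <= `|Z (t m) w - Z (t i) w|)%R].
have mF i : measurable (F i) by exact: measurable_ge.
have mev q i : measurable (ev q i) by apply: measurable_past; exact: past_ev.
have sum_ev q : P (\big[setU/set0]_(i < m.+1) (ev q i `&` F i)) <= (3^-1)%:E * P (Ev q).
  apply: (@le_trans _ _ (\sum_(i < m.+1) P (ev q i `&` F i))).
    by apply: (@Boole_inequality _ _ _ P (fun i => ev q i `&` F i)) => i _; exact: measurableI.
  apply: (@le_trans _ _ (\sum_(i < m.+1) (3^-1)%:E * P (ev q i))).
    apply: lee_sum => i _; have im : (i <= m)%N by rewrite -ltnS.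
    by rewrite past_independent// lee_wpmul2r//; exact: PF.
  rewrite -ge0_sume_distrr//; apply: lee_wpmul2l => //.
  rewrite -measure_bigsetU_ord//; last first.
    move=> i j _ _ [w [[ci ai] [cj aj]]]; apply/val_inj => /=.
    by apply: anchored_inj ai aj _; rewrite ci cj.
  apply: le_measure; rewrite ?inE; [exact: bigsetU_measurable|exact: measurable_moves_ge|].
  by rewrite -(bigcup_mkord m.+1 (ev q)) => w [i /= im [<- _]]; exact: moves_le.
have step q : P (Ev q.+1) <= (3^-1)%:E * P (Ev q) + (3^-1)%:E * P (Ev q.+1).
  apply: le_trans (leeD (sum_ev q) (sum_ev q.+1)).
  have mU r : measurable (\big[setU/set0]_(i < m.+1) (ev r i `&` F i)).
    by apply: bigsetU_measurable => i _; exact: measurableI.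
  apply: le_trans (measureU2 _ (mU q) (mU q.+1)).
  apply: le_measure; rewrite ?inE; [exact: measurable_moves_ge|exact: measurableU|].
  move=> w /moves_attained[j [jm cj aj]].
  have [i [ij ci ai zij]] := anchored_prev aj cj.
  have i_m : (i < m.+1)%N by rewrite ltnS ltnW// (leq_trans ij).
  have j_m : (j < m.+1)%N by rewrite ltnS.
  have [Fi|Fi] := boolP (e <= `|Z (t m) w - Z (t i) w|)%R.
    by left; rewrite -(bigcup_mkord _ (fun i => ev q i `&` F i)); exists i.
  right; rewrite -(bigcup_mkord _ (fun j => ev q.+1 j `&` F j)); exists j => //; split => //.
  rewrite /F /= leNgt; apply: contraNN Fi => Fj; rewrite leNgt; apply/negP => Fi.
  move: zij; apply/negP; rewrite -ltNge -(subrKA (Z (t m) w)).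
  rewrite (le_lt_trans (ler_normD _ _))// (_ : 2 * e = e + e)%R; last by ring.
  by rewrite ltrD// distrC.
elim: p => [|p IH]; first by rewrite expr0; exact: probability_le1 (measurable_moves_ge _ _).
have := step p; have := measurable_moves_ge p m; have := measurable_moves_ge p.+1 m.
move=> /(fin_num_measure P) f1 /(fin_num_measure P) f2.
move: IH; rewrite -/(Ev p) -/(Ev p.+1) -(fineK f1) -(fineK f2).
rewrite -!EFinM -EFinD !lee_fin exprS => IH st.
lra.
Qed.

End oscillation_probability.

(** * Regularisation along the rationals *)

Section rational_times.
Context {R : realType}.

Definition rational_seq (n : nat) : R :=
  if @unpickle rat n is Some r then ratr r else 0.

Lemma rational_seq_dense (x y : R) : x < y -> exists n, x < rational_seq n < y.
Proof.
move=> /rat_in_itvoo[q]; rewrite in_itv/= => xqy.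
by exists (pickle q); rewrite /rational_seq pickleK.
Qed.

Lemma rational_seq0 : exists n, rational_seq n = 0.
Proof. by exists (pickle (0 : rat)); rewrite /rational_seq pickleK rmorph0. Qed.

End rational_times.

Section oscillations.
Context {R : realType} {V : normedModType R}.
Implicit Types (z : R -> V) (e u v t : R).

Definition jump_rel e z : rel R := fun x y => (x < y) && (4 * e <= `|z x - z y|).

(** The size 4e is such that every oscillation forces a move of the anchor. *)
Definition oscillates e z u v p := exists x s,
  [/\ path (jump_rel e z) x s, size s = p &
    {in x :: s, forall y, u <= y <= v /\ range (@rational_seq R) y}].

(** Otherwise, arbitrarily close to t there are pairs of times at distance 8e,
    one of which is at distance 4e from any given later time; adding these
    times one after the other on the left yields p oscillations. *)
Lemma no_oscillation_right e z u v t p : ~ oscillates e z u v p ->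
  u <= t -> t < v ->
  exists2 r : R, 0 < r & forall n m, t < rational_seq n < t + r ->
    t < rational_seq m < t + r ->
    `|z (rational_seq n) - z (rational_seq m)| < 8 * e.
Proof.
move=> nosc ut tv; apply: contrapT => /forall2NP nr.
have far r : 0 < r -> exists n m, [/\ t < rational_seq n < t + r,
    t < rational_seq m < t + r &
    8 * e <= `|z (rational_seq n) - z (rational_seq m)|].
  move=> r0; have [//|/existsNP[n /existsNP[m]]] := nr r.
  by move=> /not_implyP[tn /not_implyP[tm /negP]]; rewrite -leNgt => h; exists n, m.
apply: nosc; suff [x [s [_ h]]] : exists x s, t < x /\
    [/\ path (jump_rel e z) x s, size s = p &
    {in x :: s, forall y, u <= y <= v /\ range (@rational_seq R) y}].
  by exists x, s.
elim: p => [|p [x [s [tx [xs sp xsuv]]]]].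
  have [n /andP[tn nv]] := rational_seq_dense tv.
  exists (rational_seq n), [::]; split=> //; split=> // y; rewrite inE => /eqP ->.
  by split; [rewrite (le_trans ut (ltW tn)) (ltW nv)|exists n].
have [n [m]] := far (x - t) ltac:(by rewrite subr_gt0).
rewrite subrKC => -[/andP[tn nx] /andP[tm mx] nm].
have [y [ty yx yD xy]] : exists y, [/\ t < y, y < x,
    range (@rational_seq R) y & 4 * e <= `|z y - z x|].
  have [nx4|nx4] := leP (4 * e) `|z (rational_seq n) - z x|.
    by exists (rational_seq n); split => //; exists n.
  exists (rational_seq m); split; [exact: tm|exact: mx|by exists m|].
  rewrite leNgt; apply/negP => mx4; move: nm; apply/negP; rewrite -ltNge.
  rewrite -(subrKA (z x)) (le_lt_trans (ler_normD _ _))//.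
  rewrite (_ : 8 * e = 4 * e + 4 * e); last by ring.
  by rewrite ltrD// distrC.
exists y, (x :: s); split=> //; split=> /=; [by rewrite /jump_rel yx xy|by rewrite sp|].
move=> y'; rewrite inE => /predU1P[->|]; last exact: xsuv.
have [/andP[_ xv] _] := xsuv x (mem_head _ _).
by split=> //; rewrite (le_trans ut (ltW ty))/= (le_trans (ltW yx) xv).
Qed.

Lemma no_oscillation_left e z u v t p : ~ oscillates e z u v p ->
  u < t -> t <= v ->
  exists2 r : R, 0 < r & forall n m, t - r < rational_seq n < t ->
    t - r < rational_seq m < t ->
    `|z (rational_seq n) - z (rational_seq m)| < 8 * e.
Proof.
move=> nosc ut tv; apply: contrapT => /forall2NP nr.
have far r : 0 < r -> exists n m, [/\ t - r < rational_seq n < t,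
    t - r < rational_seq m < t &
    8 * e <= `|z (rational_seq n) - z (rational_seq m)|].
  move=> r0; have [//|/existsNP[n /existsNP[m]]] := nr r.
  by move=> /not_implyP[tn /not_implyP[tm /negP]]; rewrite -leNgt => h; exists n, m.
apply: nosc; suff [x [s [_ h]]] : exists x s, last x s < t /\
    [/\ path (jump_rel e z) x s, size s = p &
    {in x :: s, forall y, u <= y <= v /\ range (@rational_seq R) y}].
  by exists x, s.
elim: p => [|p [x [s [lt [xs sp xsuv]]]]].
  have [n /andP[un nt]] := rational_seq_dense ut.
  exists (rational_seq n), [::]; split=> //; split=> // y; rewrite inE => /eqP ->.
  by split; [rewrite (ltW un) (le_trans (ltW nt) tv)|exists n].
set l := last x s in lt.
have [n [m]] := far (t - l) ltac:(by rewrite subr_gt0).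
rewrite subKr => -[/andP[ln nt] /andP[lm mt] nm].
have [y [ly yt yD ly4]] : exists y, [/\ l < y, y < t,
    range (@rational_seq R) y & 4 * e <= `|z l - z y|].
  have [nx4|nx4] := leP (4 * e) `|z l - z (rational_seq n)|.
    by exists (rational_seq n); split => //; exists n.
  exists (rational_seq m); split; [exact: lm|exact: mt|by exists m|].
  rewrite leNgt; apply/negP => mx4; move: nm; apply/negP; rewrite -ltNge.
  rewrite -(subrKA (z l)) (le_lt_trans (ler_normD _ _))//.
  rewrite (_ : 8 * e = 4 * e + 4 * e); last by ring.
  by rewrite ltrD// distrC.
exists x, (rcons s y); split; first by rewrite last_rcons.
split; [by rewrite rcons_path xs /jump_rel ly ly4|by rewrite size_rcons sp|].
move=> y'; rewrite -rcons_cons mem_rcons inE => /predU1P[->|]; last exact: xsuv.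
have [/andP[ul _] _] := xsuv l (mem_last _ _).
by split=> //; rewrite (le_trans (ltW yt) tv) andbT (le_trans ul (ltW ly)).
Qed.

(** The default value v keeps the sequence nondecreasing and inside [u, v]
    beyond the last rational time. *)
Definition rational_grid u v n : nat -> R := fun k =>
  nth v (sort <=%R [seq x <- map (@rational_seq R) (iota 0 n) | u <= x <= v]) k.

Definition grid_size u v n :=
  size (sort <=%R [seq x <- map (@rational_seq R) (iota 0 n) | u <= x <= v]).

Lemma rational_grid_itv u v n k : u <= v -> u <= rational_grid u v n k <= v.
Proof.
move=> uv; rewrite /rational_grid; set s := sort _ _.
have [ks|ks] := ltnP k (size s); last by rewrite nth_default// uv lexx.
by have := mem_nth v ks; rewrite mem_sort mem_filter => /andP[].
Qed.

Lemma rational_grid_nondecreasing u v n : u <= v ->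
  nondecreasing_seq (rational_grid u v n).
Proof.
move=> uv i j ij; have [js|js] := ltnP j (grid_size u v n).
  have h := sort_sorted (@le_total _ R)
    [seq x <- map (@rational_seq R) (iota 0 n) | u <= x <= v].
  by apply: (sorted_leq_nth le_trans lexx v h) => //; rewrite inE// (leq_ltn_trans ij).
rewrite [X in _ <= X]nth_default//.
by have /andP[] := rational_grid_itv n i uv.
Qed.

Lemma oscillates_moves e z u v p : 0 < e -> u <= v -> oscillates e z u v p ->
  exists N, forall n, (N <= n)%N ->
    (p <= moves e (fun k => z (rational_grid u v n k)) (grid_size u v n))%N.
Proof.
move=> e0 uv [x [s [xs sp xsuv]]].
have [N NP] : exists N, forall n, (N <= n)%N -> forall y, y \in x :: s ->
    exists2 k, (k <= grid_size u v n)%N & rational_grid u v n k = y.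
  have [N NP] : exists N, forall y, y \in x :: s ->
      exists2 k, (k < N)%N & rational_seq k = y.
    elim: (x :: s) xsuv => [|y l IH] lP; first by exists 0%N.
    have [N NP] := IH (fun y' h => lP y' (@mem_behead _ (y :: l) y' h)).
    have [_ [k _ ky]] := lP y (mem_head _ _).
    exists (maxn N k.+1) => y'; rewrite inE => /predU1P[->|/NP[k' k'N <-]].
      by exists k => //; rewrite leq_max leqnn orbT.
    by exists k' => //; rewrite leq_max k'N.
  exists N => n Nn y ys; have [k kN ky] := NP y ys.
  have yM : y \in sort <=%R [seq x <- map (@rational_seq R) (iota 0 n) | u <= x <= v].
    rewrite mem_sort mem_filter; have [-> _] := xsuv y ys.
    by apply/mapP; exists k => //; rewrite mem_iota/= add0n (leq_trans kN).
  exists (index y (sort <=%R [seq x <- map (@rational_seq R) (iota 0 n) | u <= x <= v])).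
    by rewrite ltnW// index_mem.
  by rewrite /rational_grid nth_index.
exists N => n Nn; have {}NP := NP n Nn.
set t := rational_grid u v n in NP *; set m := grid_size u v n in NP *.
suff : forall k, t k = x -> (k <= m)%N ->
    (moves e (z \o t) k + p <= moves e (z \o t) m)%N.
  have [k km kx] := NP x (mem_head _ _).
  by move=> /(_ k kx km); apply: leq_trans; rewrite leq_addl.
have nt : nondecreasing_seq t := rational_grid_nondecreasing n uv.
elim: s x p xs sp NP {xsuv} => [|y s IH] x p /=.
  by move=> _ <- _ k _ km; rewrite addn0; exact: moves_le.
move=> /andP[/andP[xy zxy] ys] <- NP k kx km.
have [l lm ly] := NP y (@mem_behead _ [:: x, y & s] y (mem_head _ _)).
have kl : (k <= l)%N.
  rewrite leqNgt; apply/negP => /ltnW/nt; rewrite kx ly.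
  by apply/negP; rewrite -ltNge.
rewrite addnS -addSn.
apply: leq_trans (IH y _ ys erefl _ l ly lm).
  by rewrite leq_add2r; apply: moves_lt => //=; rewrite kx ly.
by move=> y' y's; apply: NP; exact: (@mem_behead _ [:: x, y & s]).
Qed.

End oscillations.

Section right_limits.
Context {R : realType} {V : completeNormedModType R}.
Implicit Types (z : R -> V) (t : R).
Local Notation q := (@rational_seq R).

Definition right_regular z t := forall e, 0 < e -> exists2 r : R, 0 < r &
  forall n m, t < q n < t + r -> t < q m < t + r -> `|z (q n) - z (q m)| < e.

Definition left_regular z t := forall e, 0 < e -> exists2 r : R, 0 < r &
  forall n m, t - r < q n < t -> t - r < q m < t -> `|z (q n) - z (q m)| < e.

Definition regular z := forall t, 0 <= t ->
  right_regular z t /\ (0 < t -> left_regular z t).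

Definition right_rational t n : R :=
  q (xget 0%N [set k | t < q k < t + n.+1%:R^-1]).

Definition right_limit z t : V := lim (z (right_rational t n) @[n --> \oo]).

Lemma right_rationalP t n : t < right_rational t n < t + n.+1%:R^-1.
Proof.
rewrite /right_rational; case: xgetP => [//|].
have [|k kt] := @rational_seq_dense R t (t + n.+1%:R^-1).
  by rewrite ltrDl invr_gt0.
by move=> /(_ k) /(_ kt).
Qed.

Lemma right_rational_range t n : exists k, right_rational t n = q k.
Proof. by eexists. Qed.

Lemma near_right_rational t (r : R) : 0 < r ->
  \forall n \near \oo, t < right_rational t n < t + r.
Proof.
move=> r0; have [N _ NP] := near_infty_natSinv_lt (PosNum r0).
exists N => // n /NP /= nr; have /andP[-> tn] := right_rationalP t n.
by rewrite (lt_trans tn)// ltrD2l.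
Qed.

Lemma cvg_right_limit z t : right_regular z t ->
  z (right_rational t n) @[n --> \oo] --> right_limit z t.
Proof.
move=> zt; apply: cauchy_cvg; apply: cauchy_exP => e e0.
have [r r0 rP] := zt e e0.
have [N _ NP] := near_right_rational t r0.
have [k kN] := right_rational_range t N.
exists (z (q k)); exists N => // n /NP tn; rewrite -ball_normE/=.
have [l ln] := right_rational_range t n; rewrite ln in tn *.
by apply: rP => //; rewrite -kN; apply: NP => /=.
Qed.

Lemma right_limit_near z t (e : R) : right_regular z t -> 0 < e ->
  exists2 r : R, 0 < r & forall k, t < q k < t + r ->
    `|z (q k) - right_limit z t| <= e.
Proof.
move=> zt e0; have [r r0 rP] := zt e e0; exists r => // k kt.
have cz : `|z (q k) - z (right_rational t n)| @[n --> \oo] -->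
    `|z (q k) - right_limit z t|.
  apply: cvg_norm; apply: cvgB; [exact: cvg_cst|exact: cvg_right_limit].
rewrite -(cvg_lim (@Rhausdorff R) cz).
apply: limr_le; first by apply/cvg_ex; exists `|z (q k) - right_limit z t|.
apply: filterS (near_right_rational t r0) => n.
by have [l ->] := right_rational_range t n => tl; apply: ltW; exact: rP.
Qed.

Lemma right_limit_approx z t (r e : R) : right_regular z t -> 0 < e -> t < r ->
  exists2 k, t < q k < r & `|z (q k) - right_limit z t| <= e.
Proof.
move=> zt e0 tr; have [r' r'0 r'P] := right_limit_near zt e0.
have [|k /andP[tk kr]] := @rational_seq_dense R t (Num.min r (t + r')).
  by rewrite lt_min tr ltrDl.
rewrite lt_min in kr; have /andP[kr1 kr2] := kr.
by exists k; [rewrite tk|apply: r'P; rewrite tk].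
Qed.

Lemma right_limit_cadlag z t : regular z -> 0 <= t ->
  right_limit z s @[s --> t^'+] --> right_limit z t /\
  (0 < t -> cvg (right_limit z s @[s --> t^'-])).
Proof.
move=> zr t0; split=> [|tpos].
  apply/cvgrPdist_le => e e0; have e20 : 0 < e / 2 by rewrite divr_gt0.
  have [r r0 rP] := right_limit_near (zr t t0).1 e20.
  near=> s.
  have ts : t < s by near: s; exact: nbhs_right_gt.
  have sr : s < t + r by near: s; apply: nbhs_right_lt; rewrite ltrDl.
  have s0 : 0 <= s by rewrite (le_trans t0)// ltW.
  have [k /andP[sk kr] kP] := right_limit_approx (zr s s0).1 e20 sr.
  rewrite -(subrKA (z (q k))) (le_trans (ler_normD _ _))// [e]splitr lerD//.
  by rewrite distrC; apply: rP; rewrite (lt_trans ts).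
apply: cauchy_cvg; apply: cauchy_exP => e e0.
have e40 : 0 < e / 4 by rewrite divr_gt0.
have [r r0 rP] := (zr t t0).2 tpos _ e40.
have [|k0 k0t] := @rational_seq_dense R (t - r) t; first by rewrite ltrBlDr ltrDl.
exists (z (q k0)).
suff near_ball : \forall s \near t^'-, ball (z (q k0)) e (right_limit z s).
  exact: near_ball.
near=> s; rewrite -ball_normE/=.
have st : s < t by near: s; exact: nbhs_left_lt.
have s0 : 0 <= s by near: s; exact: nbhs_left_ge.
have rs : t - r < s by near: s; apply: nbhs_left_gt; rewrite ltrBlDr ltrDl.
have [k /andP[sk kt] kP] := right_limit_approx (zr s s0).1 e40 st.
rewrite -(subrKA (z (q k))) (le_lt_trans (ler_normD _ _))//.
apply: (@lt_trans _ _ (e / 4 + e / 2)); last by lra.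
apply: ltr_leD; first by apply: rP => //; rewrite kt (lt_trans rs).
by apply: le_trans kP _; lra.
Unshelve. all: by end_near. Qed.

End right_limits.

Section cadlag_modification.
Context {d} {T : measurableType d} {R : realType} {P : probability T R}.
Context {G : hilbertType R} (f : nat -> G).
Hypotheses (sG : separable G) (onf : orthonormal_seq f) (tf : total_seq f).
Context (Z : R -> T -> G).
Hypothesis mZ : forall s, 0 <= s -> random_element (Z s).
Hypothesis iZ : independent_increments P Z.
Local Notation q := (@rational_seq R).

(** Oscillations along rational times are seen by all sufficiently fine grids,
    so p of them have probability at most 2^-p by Fatou's lemma. *)
Lemma ae_no_oscillation (e u v : R) : 0 < e -> 0 <= u -> u <= v ->
  (forall s t, u <= s <= v -> u <= t <= v ->
    (P [set w | (e <= `|Z t w - Z s w|)%R] <= (3^-1)%:E)%E) ->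
  {ae P, forall w, exists p, ~ oscillates e (Z^~ w) u v p}.
Proof.
move=> e0 u0 uv PZ; apply: ae_of_small => c c0.
have [p _ /(_ p (leqnn p)) pc] := near_infty_natSinv_expn_lt (PosNum c0).
have t0 n : 0 <= rational_grid u v n 0.
  by have /andP[+ _] := rational_grid_itv n 0 uv; exact: le_trans.
have nt n := rational_grid_nondecreasing n uv.
pose A n := [set w | (p <= moves e (fun k => Z (rational_grid u v n k) w)
  (grid_size u v n))%N].
have mA n : measurable (A n).
  exact: (measurable_moves_ge sG onf tf e mZ (t0 n) (nt n)).
exists (eventually_in A); split; first exact: measurable_eventually_in.
- apply: prob_eventually_in_le => //; apply: nearW => n.
  apply: (@le_trans _ _ (2^-1 ^+ p)%:E); last first.
    by rewrite lee_fin exprVn -div1r; exact: ltW.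
  apply: (prob_moves_le sG onf tf mZ iZ (t0 n) (nt n)) => i _.
  by apply: PZ; exact: rational_grid_itv.
- move=> w /forallNP/(_ p)/contrapT/(oscillates_moves e0 uv)[N NP].
  by exists N.
Qed.

Hypothesis small : forall e c : R, 0 < e -> 0 < c ->
  exists2 delta : R, 0 < delta & forall s t, 0 <= s -> 0 <= t ->
    `|t - s| <= delta -> (P [set w | (e <= `|Z t w - Z s w|)%R] <= c%:E)%E.

(** Countably many intervals with rational end points, of length at most
    delta k for oscillations of size 4 * ek k, cover both sides of every time. *)
Lemma ae_regular : {ae P, forall w, regular (Z^~ w)}.
Proof.
pose ek (k : nat) : R := k.+1%:R^-1 / 8.
have ek0 k : 0 < ek k by rewrite divr_gt0// invr_gt0.
have /choice[delta deltaP] : forall k, exists delta : R, 0 < delta /\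
    forall s t, 0 <= s -> 0 <= t -> `|t - s| <= delta ->
    (P [set w | (ek k <= `|Z t w - Z s w|)%R] <= (3^-1)%:E)%E.
  move=> k; have [|delta d0 dP] := small (ek0 k) (_ : 0 < 3^-1); first by [].
  by exists delta.
have nosc k i j : {ae P, forall w, 0 <= q i -> q i <= q j ->
    q j <= q i + delta k -> exists p, ~ oscillates (ek k) (Z^~ w) (q i) (q j) p}.
  have [i0|i0] := leP 0 (q i); last by apply: aeW => w.
  have [ij|ij] := leP (q i) (q j); last by apply: aeW => w _.
  have [ijd|ijd] := leP (q j) (q i + delta k); last first.
    by apply: aeW => w _ _.
  apply: filterS (@ae_no_oscillation _ _ _ (ek0 k) i0 ij _) => // s t.
  move=> /andP[us sv] /andP[ut tv]; apply: (deltaP k).2.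
  - exact: le_trans us.
  - exact: le_trans ut.
  - by rewrite ler_norml; apply/andP; split; lra.
have := ae_foralln (fun k => ae_foralln (fun i => ae_foralln (nosc k i))).
apply: filterS => w wP t t0.
have sizes e : 0 < e -> exists k, 8 * ek k <= e.
  move=> e0; have [k _ /(_ k (leqnn k)) ke] := near_infty_natSinv_lt (PosNum e0).
  by exists k; rewrite /ek mulrC divfK// ltW.
have right_end k : exists j, t < q j < t + delta k / 2.
  by apply: rational_seq_dense; rewrite ltrDl divr_gt0//; have [] := deltaP k.
have delta0 k : 0 < delta k by have [] := deltaP k.
split=> [e e0|tpos e e0].
  have [k ke] := sizes e e0; have [j /andP[tj jd]] := right_end k.
  have [i [i0 it ti]] : exists i, [/\ 0 <= q i, q i <= t & t - delta k / 2 <= q i].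
    have [t_0|tpos] := leP t 0.
      have [i i0] := @rational_seq0 R; exists i; rewrite i0; split => //.
      by have := delta0 k; lra.
    have [|i] := @rational_seq_dense R (Num.max 0 (t - delta k / 2)) t.
      by rewrite gt_max tpos ltrBlDr ltrDl divr_gt0.
    rewrite gt_max => /andP[/andP[i0 ti] it].
    by exists i; split; exact: ltW.
  have [||p np] := wP k i j i0; [by lra|by lra|].
  have [r r0 rP] := no_oscillation_right np it tj.
  by exists r => // n m nt mt; apply: lt_le_trans ke; exact: rP.
have [k ke] := sizes e e0; have [j /andP[tj jd]] := right_end k.
have [|i] := @rational_seq_dense R (Num.max 0 (t - delta k / 2)) t.
  by rewrite gt_max tpos ltrBlDr ltrDl divr_gt0.
rewrite gt_max => /andP[/andP[i0 ti] it].
have [||p np] := wP k i j (ltW i0); [by lra|by lra|].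
have [r r0 rP] := no_oscillation_left np it (ltW tj).
by exists r => // n m nt mt; apply: lt_le_trans ke; exact: rP.
Qed.

(** By stochastic continuity, Z at rational times that decrease to t tends to
    Z_t in probability, so the right limit at t is Z_t almost surely. *)
Lemma exists_cadlag_modification : exists Y : R -> T -> G,
  cadlag_paths Y /\ forall t, 0 <= t -> {ae P, forall w, Y t w = Z t w}.
Proof.
exists (fun t w => if `[< regular (Z^~ w) >] then right_limit (Z^~ w) t else 0).
split=> [w t t0|t t0].
  case: asboolP => [zr|_]; first exact: right_limit_cadlag.
  by split=> [|_]; [exact: cvg_cst|exact: is_cvg_cst].
have rt n : 0 <= right_rational t n.
  by have /andP[/ltW + _] := right_rationalP t n; exact: le_trans.
pose u n w := `|Z (right_rational t n) w - Z t w|.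
have mu n : measurable_fun setT (u n).
  by apply: measurable_normG; apply: (random_elementB sG onf tf); exact: mZ.
have u0 (e : R) : 0 < e -> P [set w | e <= `|u n w|] @[n --> \oo] --> 0%E.
  move=> e0; have mE n : measurable [set w | e <= `|u n w|].
    exact: measurable_abs_ge.
  apply/fine_cvgP; split.
    by apply: nearW => n; rewrite fin_num_measure//; exact: mE.
  apply/cvgr0Pnorm_le => c c0; have [delta delta0 deltaP] := small e0 c0.
  near=> n; rewrite ger0_norm ?fine_ge0// -lee_fin fineK; last first.
    by rewrite fin_num_measure//; exact: mE.
  rewrite /u; under eq_set do rewrite normr_id.
  have /andP[tn nd] : t < right_rational t n < t + delta.
    by near: n; exact: near_right_rational.
  by apply: deltaP => //; rewrite ger0_norm ?subr_ge0 ?(ltW tn)// lerBlDl ltW.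
have uv : {ae P, forall w, u n w @[n --> \oo] -->
    `|(if `[< regular (Z^~ w) >] then right_limit (Z^~ w) t else 0) - Z t w|}.
  apply: filterS ae_regular => w zr; rewrite (asboolT zr).
  apply: cvg_norm; apply: cvgB; last exact: cvg_cst.
  exact: cvg_right_limit (zr t t0).1.
have := ae_eq0_of_cvg_prob mu u0 uv; apply: filterS => w /eqP.
by rewrite normr_eq0 subr_eq0 => /eqP.
Unshelve. all: by end_near. Qed.

End cadlag_modification.

Lemma complete_measurable_fun d (T : measurableType d) (R : realType)
    (P : probability T R) d' (T' : measurableType d') (U V : T -> T') :
  measure_is_complete P -> measurable_fun setT V ->
  {ae P, forall w, U w = V w} -> measurable_fun setT U.
Proof.
move=> cP mV UV _ B bB; rewrite setTI.
have [N [mN N0 UVN]] := UV.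
have VB : measurable (V @^-1` B) by rewrite -[X in measurable X]setTI; exact: mV.
have NU : measurable (U @^-1` B `&` N).
  by apply: cP; exists N; split => //; exact: subIsetr.
rewrite (_ : U @^-1` B = (V @^-1` B `\` N) `|` (U @^-1` B `&` N)).
  by apply: measurableU => //; exact: measurableD.
have out w : ~ N w -> U w = V w by move=> nN; apply: contrapT => h; exact/nN/UVN.
apply/seteqP; split=> w.
  move=> /= UB; have [Nw|nN] := pselect (N w); [by right|left].
  by split => //=; rewrite -out.
by move=> [[/= VBw nN]|[]//]; rewrite /= out.
Qed.

(** * Path regularity and uniqueness *)

Section paths.
Context {d} {T : measurableType d} {R : realType} {P : probability T R}.
Context {E : normedModType R}.
Implicit Types Y : R -> T -> E.
Local Notation q := (@rational_seq R).

Definition right_continuous_paths Y := forall w t, 0 <= t ->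
  Y s w @[s --> t^'+] --> Y t w.

Lemma cadlag_right_continuous Y : cadlag_paths Y -> right_continuous_paths Y.
Proof. by move=> cY w t t0; have [] := cY w t t0. Qed.

Lemma continuous_right_continuous Y : continuous_paths Y -> right_continuous_paths Y.
Proof.
move=> cY w t t0; have /subspace_continuousP/(_ t t0) := cY w.
move=> /cvgrPdist_lt ct; apply/cvgrPdist_lt => e e0.
have := ct e e0; rewrite !near_withinE; apply: filterS => s h ts.
by apply: h; apply: le_trans t0 _; exact: ltW.
Qed.

Lemma cvg_right_rational (E' : topologicalType) (y : R -> E') (t : R) (l : E') :
  y s @[s --> t^'+] --> l -> y (right_rational t n) @[n --> \oo] --> l.
Proof.
move=> yl; apply: (@cvg_comp _ _ _ (right_rational t) y _ t^'+) => //.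
move=> A [r /= r0 rA]; have := near_right_rational t r0.
apply: filterS => n /andP[tn nr]; apply: rA => //=.
by rewrite distrC ger0_norm ?subr_ge0 ?(ltW tn)// ltrBlDl.
Qed.

Lemma right_rational_ge0 (t : R) n : 0 <= t -> 0 <= right_rational t n.
Proof.
by have /andP[/ltW + _] := right_rationalP t n => tn t0; exact: le_trans tn.
Qed.

(** This lets processes be compared at all times outside one null set, a
    countable union over the rational times. *)
Lemma right_continuous_eq (E' : topologicalType) (y z : R -> E') :
  hausdorff_space E' ->
  (forall t, 0 <= t -> y s @[s --> t^'+] --> y t) ->
  (forall t, 0 <= t -> z s @[s --> t^'+] --> z t) ->
  (forall n, 0 <= q n -> y (q n) = z (q n)) ->
  forall t, 0 <= t -> y t = z t.
Proof.
move=> hE cy cz yz t t0.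
have yt := cvg_right_rational (cy t t0).
have zt := cvg_right_rational (cz t t0).
apply: (cvg_unique hE yt); apply: cvg_trans zt.
apply: near_eq_cvg; apply: nearW => n.
have [k kn] := right_rational_range t n.
by rewrite kn yz// -kn right_rational_ge0.
Qed.

Lemma continuous_of_sides (y : R -> E) :
  (forall t, 0 <= t -> y s @[s --> t^'+] --> y t) ->
  (forall t, 0 < t -> y s @[s --> t^'-] --> y t) ->
  {within [set t | 0 <= t], continuous y}.
Proof.
move=> ry ly; apply/subspace_continuousP => t t0.
apply/cvgrPdist_lt => e e0; rewrite near_withinE.
have /cvgrPdist_lt/(_ e e0) := ry t t0; rewrite near_withinE => ryt.
have [t_0|tpos] := leP t 0.
  apply: filterS ryt => s h s0; have [ts|st] := ltP t s; first exact: h.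
  by rewrite (_ : s = t) ?subrr ?normr0//; apply/eqP; rewrite eq_le st (le_trans t_0).
have /cvgrPdist_lt/(_ e e0) := ly t tpos; rewrite near_withinE => lyt.
apply: filter_app lyt; apply: filterS ryt => s r l _.
by have [/r//|/l//|->] := ltgtP t s; rewrite subrr normr0.
Qed.

End paths.

Section version_uniqueness.
Context {d} {T : measurableType d} {R : realType} {P : probability T R}.
Context {H G : hilbertType R} (X : R -> {linear H -> L0 P}) (A : G -> H).
Context (f : nat -> G).
Hypothesis tf : total_seq f.
Local Notation q := (@rational_seq R).
Implicit Types Y : R -> T -> G.

Lemma version_indistinguishable Y Y' :
  right_continuous_paths Y -> right_continuous_paths Y' ->
  (forall t, 0 <= t -> forall g,
    {ae P, forall w, dotp (Y t w) g = (X t (A g) : L0 P) w}) ->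
  (forall t, 0 <= t -> forall g,
    {ae P, forall w, dotp (Y' t w) g = (X t (A g) : L0 P) w}) ->
  indistinguishable P Y Y'.
Proof.
move=> rY rY' vY vY'.
have YY' n j : {ae P, forall w, 0 <= q n ->
    dotp (Y (q n) w) (f j) = dotp (Y' (q n) w) (f j)}.
  have [n0|n0] := leP 0 (q n); last by apply: aeW.
  have := vY _ n0 (f j); apply: filter_app.
  by have := vY' _ n0 (f j); apply: filterS => w -> ->.
have := ae_foralln (fun n => ae_foralln (YY' n)); apply: filterS => w YYw t t0.
apply: (@right_continuous_eq _ G (Y^~ w) (Y'^~ w) (@norm_hausdorff _ _)) => //.
- by move=> {t0}t t0; exact: rY.
- by move=> {t0}t t0; exact: rY'.
move=> n n0; apply/eqP; rewrite -subr_eq0; apply/eqP/tf => j.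
by rewrite dotpBl YYw// subrr.
Qed.

(** The coordinates of a cadlag version agree at all rational times, hence at
    all times, with continuous functions. So a left limit of the version and
    its value have the same coordinates. *)
Lemma cadlag_version_continuous Y :
  cadlag_paths Y ->
  (forall t, 0 <= t -> forall g,
    {ae P, forall w, dotp (Y t w) g = (X t (A g) : L0 P) w}) ->
  cylindrical_continuous_paths X ->
  {ae P, forall w, {within [set t | 0 <= t], continuous (Y^~ w)}}.
Proof.
move=> cY vY cX.
have /choice[Z ZP] : forall j, exists Z : R -> {mfun T >-> R},
    (forall t, 0 <= t -> X t (A (f j)) = L0_class P (Z t)) /\
    continuous_paths (fun t => Z t : T -> R).
  by move=> j; have [Z ? ?] := cX (A (f j)); exists Z.
have YZ n j : {ae P, forall w, 0 <= q n -> dotp (Y (q n) w) (f j) = Z j (q n) w}.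
  have [n0|n0] := leP 0 (q n); last by apply: aeW.
  have := vY _ n0 (f j); apply: filter_app.
  have [-> // _] := ZP j.
  by have := L0_classE P (Z j (q n)); apply: filterS => w -> ->.
have := ae_foralln (fun n => ae_foralln (YZ n)); apply: filterS => w YZw.
have rY := cadlag_right_continuous cY.
have YZt j t : 0 <= t -> dotp (Y t w) (f j) = Z j t w.
  apply: (right_continuous_eq (y := fun t => dotp (Y t w) (f j)) (z := fun t => Z j t w)).
  - exact: Rhausdorff.
  - by move=> {}t t0; apply: cvg_dotpl; exact: rY.
  - move=> {}t t0.
    exact: (@continuous_right_continuous _ _ _ _ (fun t => Z j t : T -> R) (ZP j).2).
  - by move=> n n0; exact: YZw.
apply: continuous_of_sides => t t0; first exact: rY.
have [_ /(_ t0)cl] := cY w t (ltW t0).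
set l := lim (Y s w @[s --> t^'-]) in cl.
have near0 : \forall s \near t^'-, 0 <= s by exact: nbhs_left_ge.
suff -> : Y t w = l by exact: cl.
apply/eqP; rewrite -subr_eq0; apply/eqP/tf => j; rewrite dotpBl YZt ?(ltW t0)//.
have lj : dotp (Y s w) (f j) @[s --> t^'-] --> dotp l (f j) by apply: cvg_dotpl.
have lj' : dotp (Y s w) (f j) @[s --> t^'-] --> Z j t w.
  have /subspace_continuousP/(_ t (ltW t0)) := (ZP j).2 w.
  move=> /cvgrPdist_lt ct; apply/cvgrPdist_lt => e e0.
  have := ct e e0; rewrite near_withinE => ct'.
  have lt' : \forall s \near t^'-, 0 <= s -> `|Z j t w - Z j s w| < e.
    exact: cvg_within ct'.
  near=> s; have s0 : 0 <= s by near: s.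
  by rewrite YZt//; move: s0; near: s.
by rewrite (cvg_unique (@Rhausdorff R) lj lj') subrr.
Unshelve. all: by end_near. Qed.

End version_uniqueness.

(** * Existence and uniqueness of the Levy version *)

Theorem theorem3p4 (R : realType) (d : measure_display) (T : measurableType d)
    (P : probability T R) (P_complete : measure_is_complete P)
    (H G : hilbertType R) (H_separable : separable H) (G_separable : separable G)
    (X : R -> {linear H -> L0 P}) (X_levy : cylindrical_levy X)
    (X_continuous : forall t, 0 <= t -> continuous (X t))
    (S : {linear H -> G}) (S_HS : hilbert_schmidt S) :
  exists_unique_upto_indistinguishability P (fun Y : R -> T -> G =>
    [/\ levy_process P Y, cadlag_paths Y & version_of_comp_adjoint X S Y]) /\
  (cylindrical_continuous_paths X ->
   exists_unique_upto_indistinguishability P (fun Y : R -> T -> G =>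
    [/\ levy_process P Y, continuous_paths Y & version_of_comp_adjoint X S Y])).
Proof.
have [e [oe te [C SC]]] := hilbert_schmidt_seq H_separable S_HS.
have cS : continuous S by case: S_HS.
have [B onbB] := @exists_orthonormal_basis R G.
have [f [onf tf _]] := orthonormal_basis_seq G_separable onbB.
have AC n := sum_normr2_adjoint_le cS oe te SC n onf.
pose Z t w := l0_series (X t) (adjoint S \o f) f w.
have ZX t : 0 <= t -> forall g,
    {ae P, forall w, dotp (Z t w) g = (X t (adjoint S g) : L0 P) w}.
  move=> t0 g; apply: (dotp_l0_series onf (X_continuous t t0) AC).
  exact: (cvg_adjoint_fourier cS oe te SC onf tf).
have mZ t : 0 <= t -> random_element (Z t).
  move=> t0; apply: (random_elementP G_separable onf tf) => i.
  apply: (complete_measurable_fun P_complete _ (ZX t t0 (f i))).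
  exact: measurable_L0.
have iZ := version_independent G_separable onf tf X_levy mZ ZX.
have small := version_increment_small G_separable onf tf AC X_levy X_continuous mZ ZX.
have [Y [cY YZ]] := exists_cadlag_modification G_separable onf tf mZ iZ small.
have transfer (Y' : R -> T -> G) :
    (forall t, 0 <= t -> {ae P, forall w, Y' t w = Z t w}) ->
    levy_process P Y' /\ version_of_comp_adjoint X S Y'.
  move=> Y'Z; have vY' : version_of_comp_adjoint X S Y'.
    move=> t t0 g; have := ZX t t0 g; apply: filter_app.
    by apply: filterS (Y'Z t t0) => w ->.
  split=> //; apply: (version_levy G_separable onf tf AC X_levy X_continuous _ vY').
  by move=> t t0; apply: (complete_measurable_fun P_complete (mZ t t0)); exact: Y'Z.
have [levyY vY] := transfer Y YZ.
split=> [|cX].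
  exists Y => // Y' [_ cY' vY'].
  exact: (@version_indistinguishable _ _ _ _ _ _ X (adjoint S) f tf _ _ (cadlag_right_continuous cY)
    (cadlag_right_continuous cY') vY vY').
have cYw := cadlag_version_continuous tf cY vY cX.
pose Y' t w :=
  if `[< {within [set t | 0 <= t], continuous (Y^~ w)} >] then Y t w else 0.
have cY' : continuous_paths Y'.
  move=> w; rewrite /Y'; case: asboolP => // _.
  by apply: continuous_subspaceT => t; exact: cvg_cst.
have [levyY' vY'] : levy_process P Y' /\ version_of_comp_adjoint X S Y'.
  apply: transfer => t t0; have := YZ t t0; apply: filter_app.
  by apply: filterS cYw => w cw <-; rewrite /Y' asboolT.
exists Y' => // Y'' [_ cY'' vY''].
exact: (@version_indistinguishable _ _ _ _ _ _ X (adjoint S) f tf _ _ (continuous_right_continuous cY')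
  (continuous_right_continuous cY'') vY' vY'').
Qed.
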